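(* For every composition $\mu$ with $n$ nonnegative parts (not all zero) and every $1\le i\le n-1$, $$(1-s_i)(F_\mu+F_{s_i\mu})=0,$$ and if moreover $\mu_i>\mu_{i+1}$, then $$(1-s_i)(tx_{i+1}F_\mu+x_iF_{s_i\mu})=0.$$
   Context: $s_i\mu$ swaps the $i$-th and $(i+1)$-th entries of $\mu$; on polynomials $s_i$ swaps the variables $x_i,x_{i+1}$. Multiline queues and $F_\mu$. Let $n,L$ be positive integers. A ball system is an $L\times n$ array, rows $1$ (bottom) to $L$ (top), columns $1$ to $n$, column indices mod $n$; each position empty or holding a ball; row $L$ has at least one ball and row $r-1$ has at least as many balls as row $r$. A multiline queue is a ball system with, for each $2\le r\le L$, a matching of every ball of row $r$ to a distinct ball of row $r-1$ and a labeling: balls of row $L$ get label $L$; balls of row $r$ (labels in $\{r,\dots,L\}$) are processed in decreasing order of label, right to left among equal labels; ball $b$ in column $c$ is matched to a not-yet-matched ball $b'$ of row $r-1$, where if the position in row $r-1$, column $c$ holds a not-yet-matched ball, $b$ must be matched to it (trivially paired); $b'$ gets $b$'s label; afterwards unmatched balls of row $r-1$ get label $r-1$. The type is $\mu$ with $\mu_j$ the label of the row-$1$ ball in column $j$ ($0$ if empty). Weight: $\prod_jx_j^{m_j}$ ($m_j$ = balls in column $j$) times, over each nontrivial pairing from $b$ (row $r$, column $c$, label $i$) to $b'$ (row $r-1$, column $c'\neq c$), the factor $\frac{(1-t)t^{\#\text{skipped}}}{1-q^{i-r+1}t^{\#\text{free}}}$ (times $q^{i-r+1}$ if $c'<c$),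 where at the moment of that pairing a row-$(r-1)$ ball is free if not yet matched and not trivially paired ($b'$ is free), and skipped = free balls in columns $c+1,\dots,c'-1$ mod $n$. $F_\mu=\sum$ of weights over $L\times n$ multiline queues of type $\mu$, $L=\max_j\mu_j$. *)

(* Defs.v *)
From HB Require Import structures.
From mathcomp Require Import all_boot all_order all_fingroup all_algebra.
From mathcomp Require Import mpoly.

Set Implicit Arguments.
Unset Strict Implicit.
Unset Printing Implicit Defensive.

Import GRing.Theory.
Local Open Scope ring_scope.

(* Q(q, t), the field of coefficients. *)
Definition Qqt : fieldType := {fraction {mpoly rat[2]}}.
Definition q : Qqt := FracField.tofrac ('X_ord0 : {mpoly rat[2]}).
Definition t : Qqt := FracField.tofrac ('X_ord_max : {mpoly rat[2]}).

(* A composition of length n is mu : 'I_n -> nat.  For j = i + 1 this is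
   s_i mu; [msym (tperm i j)] is the action of s_i on polynomials. *)
Definition swap_parts (n : nat) (i j : 'I_n) (mu : 'I_n -> nat) : 'I_n -> nat :=
  fun k => mu (tperm i j k).

(* Rows and columns are numbered from 0: the ordinal r stands for row r + 1
   (so row 0 is the bottom one) and the ordinal c for column c + 1.
   [mlq_pair Q (s, c) = Some c'] means that the ball in row s, column c is
   matched to the ball in row s - 1, column c'.  [mlq_label Q] is 0 at the
   empty positions. *)
Section MultilineQueue.
Variables L n : nat.

Definition mlq_data : finType :=
  ({set 'I_L * 'I_n} * {ffun 'I_L * 'I_n -> option 'I_n}
     * {ffun 'I_L * 'I_n -> 'I_L.+1})%type.

Definition mlq_balls (Q : mlq_data) : {set 'I_L * 'I_n} := Q.1.1.
Definition mlq_pair (Q : mlq_data) (p : 'I_L * 'I_n) : option 'I_n := Q.1.2 p.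
Definition mlq_label (Q : mlq_data) (p : 'I_L * 'I_n) : nat := Q.2 p.

Definition row_balls (Q : mlq_data) (r : 'I_L) : {set 'I_n} :=
  [set c | (r, c) \in mlq_balls Q].
Definition col_balls (Q : mlq_data) (c : 'I_n) : {set 'I_L} :=
  [set r | (r, c) \in mlq_balls Q].

Definition is_ball_system (Q : mlq_data) : bool :=
  [forall r : 'I_L, (r.+1 == L) ==> (0 < #|row_balls Q r|)%N]
  && [forall r : 'I_L, forall s : 'I_L,
        (s == r.+1 :> nat) ==> (#|row_balls Q s| <= #|row_balls Q r|)%N].

Definition is_matching (Q : mlq_data) : bool :=
  [&& [forall s : 'I_L, forall c : 'I_n,
         isSome (mlq_pair Q (s, c))
           == ((0 < s)%N && (c \in row_balls Q s))],
      [forall r : 'I_L, forall s : 'I_L, forall c : 'I_n, forall c' : 'I_n,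
         (s == r.+1 :> nat) && (mlq_pair Q (s, c) == Some c')
           ==> (c' \in row_balls Q r)]
    & [forall s : 'I_L, forall c1 : 'I_n, forall c2 : 'I_n, forall c' : 'I_n,
         (mlq_pair Q (s, c1) == Some c') && (mlq_pair Q (s, c2) == Some c')
           ==> (c1 == c2)]].

Definition is_labeling (Q : mlq_data) : bool :=
  [&& [forall r : 'I_L, forall c : 'I_n,
         (c \notin row_balls Q r) ==> (mlq_label Q (r, c) == 0%N)],
      [forall r : 'I_L, forall c : 'I_n,
         (r.+1 == L) && (c \in row_balls Q r) ==> (mlq_label Q (r, c) == L)],
      [forall r : 'I_L, forall s : 'I_L, forall c : 'I_n, forall c' : 'I_n,
         (s == r.+1 :> nat) && (mlq_pair Q (s, c) == Some c')
           ==> (mlq_label Q (r, c') == mlq_label Q (s, c))]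
    & [forall r : 'I_L, forall s : 'I_L, forall c' : 'I_n,
         [&& s == r.+1 :> nat, c' \in row_balls Q r
           & [forall c : 'I_n, mlq_pair Q (s, c) != Some c']]
           ==> (mlq_label Q (r, c') == r.+1)]].

(* In row s the ball in column d is processed strictly before the ball in
   column c. *)
Definition processed_before (Q : mlq_data) (s : 'I_L) (d c : 'I_n) : bool :=
  [&& d \in row_balls Q s, c \in row_balls Q s
    & (mlq_label Q (s, c) < mlq_label Q (s, d))%N
      || (mlq_label Q (s, c) == mlq_label Q (s, d)) && (c < d)%N].

(* When the ball in row s, column c gets processed, the ball of the row below
   s in column c' is already matched. *)
Definition already_matched (Q : mlq_data) (s : 'I_L) (c c' : 'I_n) : bool :=
  [exists d : 'I_n,
     processed_before Q s d c && (mlq_pair Q (s, d) == Some c')].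

Definition trivial_pairing_rule (Q : mlq_data) : bool :=
  [forall r : 'I_L, forall s : 'I_L, forall c : 'I_n,
     [&& s == r.+1 :> nat, c \in row_balls Q s, c \in row_balls Q r
       & ~~ already_matched Q s c c]
       ==> (mlq_pair Q (s, c) == Some c)].

Definition is_mlq (Q : mlq_data) : bool :=
  [&& is_ball_system Q, is_matching Q, is_labeling Q & trivial_pairing_rule Q].

Definition has_type (Q : mlq_data) (mu : 'I_n -> nat) : bool :=
  [forall r : 'I_L, forall c : 'I_n,
     (r == 0%N :> nat) ==> (mlq_label Q (r, c) == mu c)].

(* The balls of row r = s - 1 that are free when the ball in row s, column c
   gets processed.  Balls trivially paired by then are already matched, hence
   not free. *)
Definition free_balls (Q : mlq_data) (r s : 'I_L) (c : 'I_n) : {set 'I_n} :=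
  [set d in row_balls Q r | ~~ already_matched Q s c d].

(* d is one of the columns c + 1, ..., c' - 1 modulo n. *)
Definition cyc_between (c d c' : 'I_n) : bool :=
  (0 < (d + n - c) %% n < (c' + n - c) %% n)%N.

Definition skipped_balls (Q : mlq_data) (r s : 'I_L) (c c' : 'I_n) :
    {set 'I_n} :=
  [set d in free_balls Q r s c | cyc_between c d c'].

(* The exponent i - (row number of b) + 1 is i - s, as s is row s + 1. *)
Definition pairing_weight (Q : mlq_data) (r s : 'I_L) (c c' : 'I_n) : Qqt :=
  let e := (mlq_label Q (s, c) - s)%N in
  (1 - t) * t ^+ #|skipped_balls Q r s c c'|
    / (1 - q ^+ e * t ^+ #|free_balls Q r s c|)
    * (if (c' < c)%N then q ^+ e else 1).

Definition mlq_weight (Q : mlq_data) : {mpoly Qqt[n]} :=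
  (\prod_(r < L) \prod_(s < L | s == r.+1 :> nat) \prod_(c < n)
     \prod_(c' < n | (mlq_pair Q (s, c) == Some c') && (c' != c))
       pairing_weight Q r s c c')
  *: \prod_(j < n) 'X_j ^+ #|col_balls Q j|.

End MultilineQueue.

Definition F (n : nat) (mu : 'I_n -> nat) : {mpoly Qqt[n]} :=
  \sum_(Q : mlq_data (\max_(j < n) mu j) n | is_mlq Q && has_type Q mu)
    mlq_weight Q.

(* Main.v *)
Require Import Defs.
From HB Require Import structures.
From mathcomp Require Import all_boot all_order all_fingroup all_algebra.
From mathcomp Require Import mpoly ring zify.

(* Removing the bottom row of a multiline queue gives
   F_mu = x^mu * sum_nu W(nu, mu) F_nu, where nu is the word of labels of the
   second row, lowered by 1, and W(nu, mu) sums the weights of all pairings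
   between the two lowest rows.

   The pairings of label l contribute as if every ball walked to the right
   around the circle, stopping at each free ball with probability 1 - t and
   paying u = q^l per turn.  Hence W is a product over l of normalised formal
   traces sum_m u^m P_l(t^m): m counts the balls of label l passing from
   column n to column 1, and P_l is a product of elementary weights, one per
   column, taken from left to right.  Exchanging the columns i and i + 1 only
   affects two factors of each P_l, so the relations between W(nu, mu),
   W(s_i nu, mu), W(nu, s_i mu) and W(s_i nu, s_i mu) are identities between
   explicit polynomials of degree at most 2.  They carry the exchange relations
   from the F_nu to the F_mu, by induction on the number of rows. *)

Set Implicit Arguments.
Unset Strict Implicit.
Unset Printing Implicit Defensive.

Import GRing.Theory.
Local Open Scope ring_scope.

(** * Transfer polynomials of a two-row system *)

(** The obstacle is that the weight of a pairing depends on the free balls at the moment it is made,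
    so exchanging two columns disturbs the processing order and the cyclic counts of the other
    pairings. The trace removes the order: for one label, the number of balls in flight over each
    column is determined by the number m of balls that cross from the last column to the first, and
    ['X] stands for t^m. No convergence is involved, since the series is summed on monomials and the
    only operation on m is the shift by one. The labels do not interact: a lower label finds fewer
    free balls below, but the missing ones are exactly those of greater final label, and these can
    be read off from [mu]. Hence the product over labels is exact. Both relations must be carried
    through the induction at once, because the coefficients of F_nu and F_(s_i nu) in a longer sum
    are in general a combination of the two. *)

Section Phi.
Variables (K : fieldType) (t u : K).

(* The formal trace sum_m u^m p(t^m), with each geometric series summed. *)
Definition phi (p : {poly K}) : K := \sum_(k < size p) p`_k / (1 - u * t ^+ k).

Lemma phi_widen (p : {poly K}) m :
  (size p <= m)%N -> phi p = \sum_(k < m) p`_k / (1 - u * t ^+ k).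
Proof.
move=> le_pm; rewrite /phi.
rewrite (big_ord_widen m (fun k => p`_k / (1 - u * t ^+ k)) le_pm).
rewrite big_mkcond; apply: eq_bigr => k _; case: ltnP => // le_pk.
by rewrite nth_default // mul0r.
Qed.

Lemma phi_is_linear : linear_for *%R phi.
Proof.
move=> a p r.
set m := maxn (size (a *: p + r)) (maxn (size p) (size r)).
rewrite (@phi_widen (a *: p + r) m) ?leq_max ?leqnn //.
rewrite (@phi_widen p m) ?leq_max ?leqnn ?orbT //.
rewrite (@phi_widen r m) ?leq_max ?leqnn ?orbT //.
rewrite big_distrr -big_split; apply: eq_bigr => k _ /=.
by rewrite coefD coefZ mulrDl mulrA.
Qed.

HB.instance Definition _ := GRing.isLinear.Build K {poly K} K *%R phi phi_is_linear.

Lemma phiXn k : phi 'X^k = (1 - u * t ^+ k)^-1.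
Proof.
rewrite (@phi_widen _ k.+1) ?size_polyXn // big_ord_recr /= coefXn eqxx mul1r.
rewrite big1 ?add0r // => i _; rewrite coefXn.
by rewrite (ltn_eqF (ltn_ord i)) mul0r.
Qed.

Hypothesis unz : forall k, 1 - u * t ^+ k != 0.

(** Splits off the term m = 0 of the series, which is p(1); in the rest, replacing m by m + 1 costs
    a factor u and rescales the variable by t. This is one turn around the circle. *)
Lemma phi_shift (p : {poly K}) :
  phi p = u * phi (p \Po (t *: 'X)) + p.[1].
Proof.
have eP : p = \sum_(k < size p) p`_k *: 'X^k by rewrite -poly_def coefK.
rewrite {1 2}eP !raddf_sum /=.
rewrite horner_coef mulr_sumr -big_split; apply: eq_bigr => k _ /=.
rewrite comp_polyZ comp_Xn_poly exprZn !linearZ /= phiXn expr1n mulr1.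
by move: (unz k) => nz; field.
Qed.

End Phi.

(** * Weights of a line of columns, read from left to right *)

Section Run.
Variables (K : fieldType) (t : K).
Hypothesis tnz : t != 0.

(* The three bits of a column, for a fixed label: a ball above carries it, the
   ball below receives it, the ball below is free when it gets processed. *)
Definition column : Type := (bool * bool * bool)%type.

(* With m balls passing over a column and s * z = t^m, [cell x s] is the weight
   of the column and [step x] turns s into the scale of the next column. *)
Definition step (x : column) : K := t ^+ x.1.1 / t ^+ x.1.2.

Definition cell (x : column) (s : K) : {poly K} :=
  if x.2 then
    if x.1.1 then x.1.2%:R else if x.1.2 then 1 - s *: 'X else s *: 'X
  else 1.

Section Seq.
Variable I : eqType.
Implicit Types (col : I -> column) (cs : seq I).

Fixpoint run col (s : K) cs : {poly K} :=
  if cs is c :: cs' then cell (col c) s * run col (s * step (col c)) cs' else 1.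

Fixpoint scale col (s : K) cs : K :=
  if cs is c :: cs' then scale col (s * step (col c)) cs' else s.

Lemma run_cat col s cs1 cs2 :
  run col s (cs1 ++ cs2) = run col s cs1 * run col (scale col s cs1) cs2.
Proof.
by elim: cs1 s => [|c cs1 IH] s /=; rewrite ?mul1r // IH mulrA.
Qed.

Lemma scaleM col a s cs : scale col (a * s) cs = a * scale col s cs.
Proof. by elim: cs s => [|c cs IH] s //=; rewrite -IH mulrA. Qed.

Lemma eq_run col col' s cs :
  {in cs, col =1 col'} -> run col s cs = run col' s cs.
Proof.
elim: cs s => [|c cs IH] s //= eqc.
rewrite eqc ?mem_head // IH // => d dcs; apply: eqc.
by rewrite in_cons dcs orbT.
Qed.

Lemma eq_scale col col' s cs :
  {in cs, col =1 col'} -> scale col s cs = scale col' s cs.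
Proof.
elim: cs s => [|c cs IH] s //= eqc.
rewrite eqc ?mem_head // IH // => d dcs; apply: eqc.
by rewrite in_cons dcs orbT.
Qed.

(** The scale enters every cell only through [s *: 'X], so one more ball in flight at the start is
    the same as one more ball crossing from the last column to the first. *)
Lemma run_comp col a s cs : run col (a * s) cs = run col s cs \Po (a *: 'X).
Proof.
elim: cs s => [|c cs IH] s /=; first by rewrite -polyC1 comp_polyC.
rewrite comp_polyM -mulrA IH; congr (_ * _).
have eX : (a * s) *: 'X = (s *: 'X) \Po (a *: 'X) :> {poly K}.
  by rewrite comp_polyZ comp_polyX scalerA mulrC.
rewrite /cell; case: (col c).2; last by rewrite -polyC1 comp_polyC.
case: (col c).1.1; first by rewrite -polyC_natr comp_polyC.
case: (col c).1.2 => //.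
by rewrite comp_polyB -eX -polyC1 comp_polyC.
Qed.

(* The exponent of the scale starts at h >= 0 and ends below 0; the column where
   it drops from 0 to -1 has the factor 1 - 'X, which vanishes at 1. *)
Lemma run_vanish col h cs :
  (forall c, (col c).1.2 -> (col c).2) ->
  (h + count (fun c => (col c).1.1) cs < count (fun c => (col c).1.2) cs)%N ->
  (run col (t ^+ h) cs).[1] = 0.
Proof.
move=> bu; elim: cs h => [|c cs IH] h //=; rewrite hornerM /step.
move: (bu c); rewrite /cell; case: (col c) => [[a b] v] /= bv; case: a bv => bv.
  case: b bv => bv lt_h.
    by rewrite expr1 divff // mulr1 IH ?mulr0 //; lia.
  by rewrite expr1 invr1 mulr1 -exprSr IH ?mulr0 //; lia.
case: b bv => [/(_ isT) ->|_] lt_h; last by rewrite mul1r invr1 mulr1 IH ?mulr0.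
case: h lt_h => [|h] lt_h; last first.
  by rewrite mul1r exprSr expr1 mulfK // IH ?mulr0 //; lia.
by rewrite scale1r !hornerE subrr mul0r.
Qed.

(** The column after its lower ball has been taken by the walking ball: it neither receives nor is
    free any more. *)
Definition clear_below (x : column) : column := (x.1.1, false, false).
Definition clear_at col d : I -> column :=
  fun c => if c == d then clear_below (col c) else col c.

Lemma clear_at_id col d : clear_at col d d = clear_below (col d).
Proof. by rewrite /clear_at eqxx. Qed.

Lemma clear_at_neq col d c : c != d -> clear_at col d c = col c.
Proof. by rewrite /clear_at => /negbTE->. Qed.

End Seq.

(** A receiver that is gone stops no ball, so one ball more goes on to the right. *)
Lemma scale_clear_at (I : eqType) (col : I -> column) d s cs :
  uniq cs -> d \in cs -> (col d).1.2 ->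
  scale (clear_at col d) s cs = t * scale col s cs.
Proof.
elim: cs s => [|c cs IH] s //= /andP[c_cs u_cs].
rewrite in_cons => /predU1P[-> bd|d_cs bd]; last first.
  rewrite clear_at_neq ?IH //; apply/eqP => e; by rewrite e d_cs in c_cs.
rewrite clear_at_id -scaleM; rewrite (@eq_scale _ _ col); last first.
  by move=> e e_cs; rewrite clear_at_neq //; apply: contraNneq c_cs => <-.
congr scale; rewrite /step /= bd expr1 invr1 mulr1.
by move: (t ^+ _) => y; field.
Qed.

(** One extra ball enters from the left. Either it passes every free ball, at a factor t each, or it
    stops at a receiver [d] with factor 1 - t after passing the free balls before [d]. At a receiver
    with no ball above, this is 1 - t s X = t (1 - s X) + (1 - t). *)
Lemma walk n (col : 'I_n -> column) s cs :
  (forall c, (col c).1.2 -> (col c).2) ->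
  sorted (fun c d : 'I_n => c < d)%N cs ->
  run col (t * s) cs =
    t ^+ count (fun c => (col c).2) cs *: run col s cs
    + (1 - t) *: \sum_(d <- cs)
        ((col d).1.2%:R * t ^+ count (fun c => (col c).2 && (c < d)%N) cs)
          *: run (clear_at col d) s cs.
Proof.
move=> bu; elim: cs s => [|c cs IH] s; first by rewrite big_nil scaler0 addr0 scale1r.
rewrite /= path_sortedE; last by move=> ? ? ?; apply: ltn_trans.
case/andP=> /allP c_lt cs_sorted; rewrite -mulrA IH //.
have notin d : d \in cs -> (c == d) = false.
  by move/c_lt=> lt_cd; apply/negbTE/eqP => eq_cd; rewrite eq_cd ltnn in lt_cd.
have no_cs : {in cs, clear_at col c =1 col}.
  by move=> d dcs; rewrite /clear_at eq_sym notin.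
have cnt0 : count (fun d => (col d).2 && (d < c)%N) cs = 0%N.
  apply/eqP; rewrite -leqn0 leqNgt -has_count; apply/negP => /hasP[d dcs /andP[_]].
  by rewrite ltnNge ltnW // c_lt.
rewrite big_cons ltnn andbF cnt0 mulr1 (eq_run _ no_cs) clear_at_id.
pose S := \sum_(d <- cs) ((col d).1.2%:R * t ^+ count (fun c => (col c).2 && (c < d)%N) cs)
   *: run (clear_at col d) (s * step (col c)) cs.
have -> : \sum_(d <- cs) ((col d).1.2%:R * t ^+ ((col c).2 && (c < d)%N
     + count (fun c => (col c).2 && (c < d)%N) cs))
   *: (cell (clear_at col d c) s * run (clear_at col d) (s * step (clear_at col d c)) cs)
   = t ^+ (col c).2 *: (cell (col c) s * S).
  rewrite mulr_sumr scaler_sumr; apply: eq_big_seq => d dcs.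
  rewrite clear_at_neq ?notin // (c_lt _ dcs) andbT exprD mulrCA.
  by rewrite -[LHS]scalerA -scalerAr.
(* The induction hypothesis eliminates [S]; only an identity between [R] and [R'] is left, which is
   checked on the bits of the column [c]. *)
have := IH (s * step (col c)) cs_sorted; rewrite -/S => /esym/(canRL (addrK _)).
set R := run col (t * _) cs; set R' := run col (s * _) cs => eR.
(* If the extra ball stops at [c] itself, the balls already in flight all pass [c], so the remaining
   columns still see one ball more. *)
have -> : (col c).1.2%:R *: (cell (clear_below (col c)) s *
      run col (s * step (clear_below (col c))) cs) = (col c).1.2%:R *: R.
  case e: (col c).1.2; last by rewrite !scale0r.
  rewrite {1}/cell /= mul1r /R; congr (_ *: run _ _ _).
  by rewrite /step /= e expr1 invr1 mulr1 mulrCA [t * _]mulrC divfK // mulrC.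
rewrite -IH // -/R exprD -scalerA scalerAr eR.
move: (bu c); rewrite /cell /=; case: (col c) => [[a b] v] /= bv.
case: v bv => bv; last first.
  case: b bv => [/(_ isT)//|_]; rewrite !mul1r !scale1r scale0r add0r.
  by rewrite subrK.
rewrite -!mul_polyC !expr1.
case: a; case: b bv => _; rewrite ?(polyCB, polyCM, polyC1, polyC_natr) /= ?mulr1n ?mulr0n; ring.
Qed.

End Run.

(** * Normalised traces on the circle *)

Section ModeValue.
Variables (K : fieldType) (t u : K).
Hypothesis tnz : t != 0.
Hypothesis unz : forall k, 1 - u * t ^+ k != 0.
Variable n : nat.
Implicit Type col : 'I_n -> column.

(** The prefactor gives the value 1 when no ball of the label is left: each remaining free ball then
    contributes a factor ['X]. Its exponent counts the free balls that this label does not take, so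
    it does not change while the label is being processed. *)
Definition mode_value col : K :=
  (1 - u * t ^+ #|[set c | (col c).2 && ~~ (col c).1.2]|)
  * phi t u (run t col 1 (enum 'I_n)).

Lemma cyc_distE (a c : 'I_n) :
  ((c + n - a) %% n = if a <= c then c - a else c + n - a)%N.
Proof.
have [lt_a lt_c] := (ltn_ord a, ltn_ord c).
case: leqP => h; last by rewrite modn_small //; lia.
have -> : (c + n - a = c - a + n)%N by lia.
by rewrite modnDr modn_small //; lia.
Qed.

Lemma cyc_betweenE (a c d : 'I_n) : d != a ->
  cyc_between a c d = (if a < d then a < c < d else (a < c) || (c < d))%N.
Proof.
rewrite -val_eqE /= => neq; rewrite /cyc_between !cyc_distE.
have [[lt_a lt_c] lt_d] := (ltn_ord a, ltn_ord c, ltn_ord d).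
by case: (leqP a c) => h1; case: (leqP a d) => h2; case: (ltnP a d) => h3; lia.
Qed.

Lemma sorted_enum_ord : sorted (fun c d : 'I_n => c < d)%N (enum 'I_n).
Proof.
have := iota_ltn_sorted 0 n; rewrite -val_enum_ord.
by rewrite sorted_map.
Qed.

Lemma split_enum_ord (a : 'I_n) : exists cs1 cs2,
  [/\ enum 'I_n = cs1 ++ a :: cs2,
      {in cs1, forall c : 'I_n, c < a}%N, {in cs2, forall c : 'I_n, a < c}%N,
      sorted (fun c d : 'I_n => c < d)%N cs1
    & sorted (fun c d : 'I_n => c < d)%N cs2].
Proof.
have := sorted_enum_ord; have := mem_enum 'I_n a; rewrite inE.
case/splitPr => cs1 cs2; rewrite sorted_pairwise; last first.
  by move=> ? ? ?; apply: ltn_trans.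
rewrite pairwise_cat /= => /and3P[/allrelP h1 h2 /andP[/allP h3 h4]].
exists cs1, cs2; split=> //.
- by move=> c c1; apply: h1 => //; apply: mem_head.
- by rewrite sorted_pairwise // => ? ? ?; apply: ltn_trans.
- by rewrite sorted_pairwise // => ? ? ?; apply: ltn_trans.
Qed.

Lemma card_count_enum (P : pred 'I_n) : #|[set c | P c]| = count P (enum 'I_n).
Proof.
rewrite cardE {1}/enum_mem size_filter enumT.
by apply: eq_count => c; rewrite /= inE.
Qed.

Definition clear_above_at col a : 'I_n -> column :=
  fun c => if c == a then (false, (col c).1.2, (col c).2) else col c.

(* The unmatched ball above column a walks to the right, stopping at each free
   ball with probability 1 - t and paying u for every turn around the circle;
   summing over the number of turns gives the denominator. *)
Lemma mode_value_walk col (a : 'I_n) :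
  (forall c, (col c).1.2 -> (col c).2) ->
  col a = (true, false, false) ->
  #|[set c | (col c).1.1]| = #|[set c | (col c).1.2]| ->
  (1 - u * t ^+ #|[set c | (col c).2]|) * mode_value col =
  \sum_(d | (col d).1.2)
    (1 - t) * t ^+ #|[set c | (col c).2 && cyc_between a c d]|
    * (if (d < a)%N then u else 1)
    * mode_value (clear_at (clear_above_at col a) d).
Proof.
move=> bu ca eqAB.
set col' := clear_above_at col a.
have bu' c : (col' c).1.2 -> (col' c).2.
  by rewrite /col' /clear_above_at; case: eqP => // _; apply: bu.
have c'a : col' a = (false, false, false).
  by rewrite /col' /clear_above_at eqxx ca.
have c'N c : c != a -> col' c = col c.
  by rewrite /col' /clear_above_at => /negbTE->.
have c'2 c : (col' c).1.2 = (col c).1.2 /\ (col' c).2 = (col c).2.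
  by rewrite /col' /clear_above_at; case: eqP.
have bd_neq d : (col d).1.2 -> d != a.
  by move=> bd; apply/eqP => eda; rewrite eda ca in bd.
have cst d : (col d).1.2 ->
  #|[set c | (clear_at col' d c).2 && ~~ (clear_at col' d c).1.2]| =
  #|[set c | (col c).2 && ~~ (col c).1.2]|.
  move=> bd; congr #|pred_of_set _|; apply/setP => c; rewrite !inE.
  rewrite /clear_at; case: eqP => [->|_] /=; first by rewrite bd andbF.
  by case: (c'2 c) => -> ->.
rewrite /mode_value mulrCA.
under [RHS]eq_bigr => d bd do rewrite cst // mulrCA.
rewrite -mulr_sumr; congr (_ * _).
have [cs1 [cs2 [eE lt1 lt2 so1 so2]]] := split_enum_ord a.
have ne1 c : c \in cs1 -> c != a.
  by move/lt1 => h; rewrite -val_eqE /= ltn_eqF.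
have ne2 c : c \in cs2 -> c != a.
  by move/lt2 => h; rewrite -val_eqE /= gtn_eqF.
pose s1 := scale t col' 1 cs1.
pose P := run t col 1 (enum 'I_n); pose Q := run t col' 1 (enum 'I_n).
pose Pd d := run t (clear_at col' d) 1 (enum 'I_n).
pose U1 := count (fun c => (col c).2) cs1; pose U2 := count (fun c => (col c).2) cs2.
have eU : #|[set c | (col c).2]| = (U1 + U2)%N.
  by rewrite card_count_enum eE count_cat /= ca.
(* The ball above [a] is felt only to the right of [a], where it multiplies the scale by t. *)
have eP : P = run t col' 1 cs1 * run t col' (t * s1) cs2.
  rewrite /P eE run_cat /= ca /step /= /cell /= mul1r invr1 mulr1 expr1.
  rewrite (@eq_run _ _ _ col col' _ cs1); last by move=> c c1; rewrite c'N ?ne1.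
  rewrite (@eq_run _ _ _ col col' _ cs2); last by move=> c c1; rewrite c'N ?ne2.
  rewrite (@eq_scale _ _ _ col col' _ cs1); last by move=> c c1; rewrite c'N ?ne1.
  by rewrite -/s1 [t * s1]mulrC.
have run_a cl s (cla : cl a = (false, false, false)) :
    run t cl s (enum 'I_n) = run t cl s cs1 * run t cl (scale t cl s cs1) cs2.
  by rewrite eE run_cat /= cla /step /= /cell /= mul1r invr1 !mulr1.
have ca_d d : d != a -> clear_at col' d a = (false, false, false).
  by move=> da; rewrite clear_at_neq // eq_sym.
have uE := enum_uniq 'I_n; rewrite eE cat_uniq /= in uE.
case/and4P: uE => u1 dis _ u2.
pose k1 d := count (fun c => (col c).2 && (c < d)%N) cs1.
pose k2 d := count (fun c => (col c).2 && (c < d)%N) cs2.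
have cnt' cs d : count (fun c => (col' c).2 && (c < d)%N) cs =
                 count (fun c => (col c).2 && (c < d)%N) cs.
  by apply: eq_count => c; case: (c'2 c) => _ ->.
have cntU' cs : count (fun c => (col' c).2) cs = count (fun c => (col c).2) cs.
  by apply: eq_count => c; case: (c'2 c) => _ ->.
have lt12 c d : c \in cs1 -> d \in cs2 -> c != d.
  by move=> /lt1 hc /lt2 hd; rewrite -val_eqE /= ltn_eqF // (ltn_trans hc).
have eP2 : P = t ^+ U2 *: Q
    + (1 - t) *: \sum_(d <- cs2) ((col d).1.2%:R * t ^+ k2 d) *: Pd d.
  rewrite eP walk // cntU' -/U2 mulrDr -!scalerAr /Q run_a // mulr_sumr.
  congr (_ + _ *: _); apply: eq_big_seq => d d2.
  rewrite cnt' -/(k2 d) -scalerAr; case: (c'2 d) => -> _.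
  rewrite /Pd run_a ?ca_d ?ne2 //.
  have eq1 : {in cs1, clear_at col' d =1 col'}.
    by move=> c c1; rewrite clear_at_neq // lt12.
  by rewrite (eq_run _ _ eq1) (eq_scale _ _ eq1).
(* The same ball after crossing to the first column. If it passes [cs1], it is back above [a], which
   restores [P]; if it stops at [d] in [cs1], the missing receiver raises the scale on [cs2] by t,
   as in [Pd d]. *)
have eQ : Q \Po (t *: 'X) = t ^+ U1 *: P
    + (1 - t) *: \sum_(d <- cs1) ((col d).1.2%:R * t ^+ k1 d) *: Pd d.
  rewrite -run_comp run_a // scaleM -/s1 walk // cntU' -/U1 mulrDl -!scalerAl -eP.
  rewrite mulr_suml; congr (_ + _ *: _); apply: eq_big_seq => d d1.
  rewrite cnt' -/(k1 d) -scalerAl; case: (c'2 d) => eb _; rewrite -eb.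
  case bd: (col' d).1.2; last by rewrite !mul0r !scale0r.
  rewrite /Pd run_a ?ca_d ?ne1 // scale_clear_at // -/s1; congr (_ *: (_ * _)).
  apply: eq_run => c c2; rewrite clear_at_neq // eq_sym; exact: lt12.
(* Without the ball above [a] there are fewer balls than receivers, so the term m = 0 of the trace
   of [Q] vanishes. *)
have Q1 : Q.[1] = 0.
  rewrite /Q -(expr0 t); apply: run_vanish => //.
  rewrite add0n -!card_count_enum; have -> : [set c | (col' c).1.2] = [set c | (col c).1.2].
    by apply/setP => c; rewrite !inE; case: (c'2 c) => ->.
  rewrite -eqAB; apply: proper_card; apply/properP; split.
    apply/subsetP => c; rewrite !inE; case: (eqVneq c a) => [->|/c'N ->] //.
    by rewrite c'a.
  by exists a; rewrite !inE ?ca ?c'a.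
(* Eliminating the trace of [Q] leaves a linear equation for the trace of [P] with coefficient 1 - u
   t^(U1 + U2), the denominator of a pairing weight. *)
have fQ := phi_shift unz Q; rewrite Q1 addr0 eQ in fQ.
have fP := congr1 (phi t u) eP2.
rewrite linearD /= !linearZ /= in fP; rewrite linearD /= !linearZ /= in fQ.
rewrite fQ in fP; rewrite -/P eU exprD.
set S2 := phi t u (\sum_(d <- cs2) _) in fP.
set S1 := phi t u (\sum_(d <- cs1) _) in fP.
transitivity ((1 - t) * S2 + t ^+ U2 * u * (1 - t) * S1).
  by rewrite mulrBl mul1r {1}fP; ring.
rewrite big_mkcond /=.
have -> (f : 'I_n -> K) : \sum_d f d = \sum_(d <- enum 'I_n) f d by rewrite big_enum.
rewrite eE big_cat big_cons /=.
rewrite ca /= add0r addrC -eE; congr (_ + _).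
  rewrite /S2 raddf_sum mulr_sumr /=; apply: eq_big_seq => d d2.
  case bd: (col d).1.2; last by rewrite mul0r scale0r raddf0 mulr0.
  rewrite linearZ /= mul1r -/(Pd d) ltnNge (ltnW (lt2 _ d2)) mulr1 mulrA.
  congr (_ * t ^+ _ * _); rewrite card_count_enum eE count_cat /= ca add0n /k2.
  rewrite [X in (X + _)%N](_ : _ = 0%N) ?add0n; last first.
    rewrite -(count_pred0 cs1); apply: eq_in_count => c c1 /=.
    rewrite cyc_betweenE ?ne2 // lt2 // ltnNge (ltnW (lt1 _ c1)) andbF //.
  apply: eq_in_count => c c2; rewrite cyc_betweenE ?ne2 // lt2 //.
  by rewrite (lt2 _ c2).
rewrite /S1 raddf_sum mulr_sumr /=; apply: eq_big_seq => d d1.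
case bd: (col d).1.2; last by rewrite mul0r scale0r raddf0 mulr0.
rewrite linearZ /= mul1r -/(Pd d) (lt1 _ d1).
have -> : #|[set c | (col c).2 && cyc_between a c d]| = (U2 + k1 d)%N.
  rewrite card_count_enum eE count_cat /= ca add0n addnC /U2 /k1; congr (_ + _)%N.
    apply: eq_in_count => c c2; rewrite cyc_betweenE ?ne1 //.
    by rewrite ltnNge (ltnW (lt1 _ d1)) lt2 // andbT.
  apply: eq_in_count => c c1; rewrite cyc_betweenE ?ne1 //.
  by rewrite ltnNge (ltnW (lt1 _ d1)) /= ltnNge (ltnW (lt1 _ c1)).
by rewrite exprD; ring.
Qed.

Lemma mode_value_empty col :
  (forall c, (col c).1 = (false, false)) -> mode_value col = 1.
Proof.
move=> c0; rewrite /mode_value card_count_enum.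
have -> cs : run t col 1 cs = 'X^(count (fun c => (col c).2 && ~~ (col c).1.2) cs).
  elim: cs => //= c cs IH; rewrite /step c0 /= invr1 !mulr1 IH /cell.
  case: (col c) (c0 c) => [[a b] [] [-> ->]]; last by rewrite mul1r.
  by rewrite scale1r exprS.
by rewrite phiXn divff.
Qed.

(** Such a column violates the trivial pairing rule: the free ball below would have to be matched to
    the ball above, but its label is wrong. *)
Lemma mode_value_zero col c : col c = (true, false, true) -> mode_value col = 0.
Proof.
move=> cc; rewrite /mode_value; have := mem_enum 'I_n c; rewrite inE.
case/splitPr => cs1 cs2; rewrite run_cat /= cc /cell /=.
by rewrite mul0r mulr0 raddf0 mulr0.
Qed.

Lemma mode_value_trivial col col' c :
  col c = (true, true, true) -> col' c = (false, false, false) ->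
  (forall d, d != c -> col' d = col d) -> mode_value col' = mode_value col.
Proof.
move=> cc cc' cN; congr ((1 - u * t ^+ _) * _).
  congr #|pred_of_set _|; apply/setP => d; rewrite !inE.
  by have [->|/cN ->] := eqVneq d c; rewrite ?cc ?cc'.
congr phi; elim: (enum _) (1 : K) => //= d cs IH s.
have [->|/cN ->] := eqVneq d c; last by rewrite IH.
by rewrite cc cc' IH /step /= expr1 expr0 divr1 divff.
Qed.

Lemma eq_mode_value col col' : col =1 col' -> mode_value col = mode_value col'.
Proof.
move=> eqc; congr ((1 - u * t ^+ _) * _).
  by congr #|pred_of_set _|; apply/setP => d; rewrite !inE eqc.
by congr phi; apply: eq_run => c _.
Qed.

End ModeValue.

(** * Two-row pairings as products over labels *)

Lemma t_neq0 : t != 0.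
Proof.
rewrite /t tofrac_eq0; apply/eqP => /(congr1 (meval (fun=> 1))).
by rewrite mevalXU meval0 => /eqP; rewrite oner_eq0.
Qed.

(** Since the exponent of q is positive, the expression takes the value 1 at q = t = 0. *)
Lemma qt_neq1 l k : 1 - q ^+ l.+1 * t ^+ k != 0.
Proof.
rewrite /q /t -!tofracXn -tofracM -(tofrac1 _) -tofracB tofrac_eq0.
apply/eqP => /(congr1 (meval (fun=> 0))).
rewrite rmorphB rmorphM !rmorphXn /= mevalXU meval0 meval1 expr0n mul0r subr0.
by move/eqP; rewrite oner_eq0.
Qed.

Section Kernel.
Variables (n : nat) (nu mu : 'I_n -> nat).
Implicit Types (c d : 'I_n) (s : seq 'I_n) (U : {set 'I_n}).
Implicit Type p : {ffun 'I_n -> option 'I_n}.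

Definition before d c : bool :=
  [&& 0 < nu d, 0 < nu c & (nu c < nu d) || (nu c == nu d) && (c < d)]%N.

Definition matched p c d : bool := [exists x, before x c && (p x == Some d)].

Definition free_set p c : {set 'I_n} := [set d | (0 < mu d)%N && ~~ matched p c d].

(** For a ball of label i in the second row the exponent i - r + 1 is i - 1, which is the lowered
    label stored in [nu]. *)
Definition pair_weight (e : nat) U c d : Qqt :=
  (1 - t) * t ^+ #|[set x in U | cyc_between c x d]| / (1 - q ^+ e * t ^+ #|U|)
  * (if (d < c)%N then q ^+ e else 1).

Definition pvalid p : bool :=
  [&& [forall c, isSome (p c) == (0 < nu c)%N],
      [forall c, forall d, (p c == Some d) ==> (mu d == (nu c).+1)],
      [forall c, forall c', forall d,
         (p c == Some d) && (p c' == Some d) ==> (c == c')],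
      [forall d, (0 < mu d)%N && [forall c, p c != Some d] ==> (mu d == 1%N)]
    & [forall c, [&& (0 < nu c)%N, (0 < mu c)%N & ~~ matched p c c]
         ==> (p c == Some c)]].

Lemma pvalidP p : reflect
  [/\ forall c, isSome (p c) = (0 < nu c)%N,
      forall c d, p c = Some d -> mu d = (nu c).+1,
      forall c c' d, p c = Some d -> p c' = Some d -> c = c',
      forall d, (0 < mu d)%N -> (forall c, p c != Some d) -> mu d = 1%N
    & forall c, (0 < nu c)%N -> (0 < mu c)%N -> ~~ matched p c c ->
        p c = Some c]
  (pvalid p).
Proof.
apply: (iffP and5P) => [] [h1 h2 h3 h4 h5]; split.
- by move=> c; apply/eqP/(forallP h1).
- by move=> c d /eqP pc; apply/eqP; move/forallP/(_ c)/forallP/(_ d)/implyP: h2; apply.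
- move=> c c' d /eqP pc /eqP pc'; apply/eqP.
  by move/forallP/(_ c)/forallP/(_ c')/forallP/(_ d)/implyP: h3; apply; rewrite pc.
- move=> d d0 /forallP dN; apply/eqP.
  by move/forallP/(_ d)/implyP: h4; apply; rewrite d0.
- move=> c c1 c2 c3; apply/eqP; move/forallP/(_ c)/implyP: h5; apply.
  by rewrite c1 c2.
- by apply/forallP => c; rewrite h1.
- by apply/forallP => c; apply/forallP => d; apply/implyP => /eqP /h2 ->.
- apply/forallP => c; apply/forallP => c'; apply/forallP => d.
  by apply/implyP => /andP[/eqP pc /eqP pc']; rewrite (h3 c c' d).
- by apply/forallP => d; apply/implyP => /andP[d0 /forallP dN]; rewrite h4.
- by apply/forallP => c; apply/implyP => /and3P[c1 c2 c3]; rewrite h5.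
Qed.

Definition pairing_prod p : Qqt :=
  \prod_c \prod_(d | (p c == Some d) && (d != c))
    pair_weight (nu c) (free_set p c) c d.

Definition kernel : Qqt := \sum_(p | pvalid p) pairing_prod p.

(** [U] is the set of free balls when [c] is processed. Forbidden choices get weight 0, so that sums
    can range over all partial maps on the given balls. *)
Definition choice_weight c (od : option 'I_n) U : Qqt :=
  if od is Some d then
    if c \in U then ((d == c) && (mu d == (nu c).+1))%:R
    else if (d \in U) && (mu d == (nu c).+1) then pair_weight (nu c) U c d else 0
  else 0.

Fixpoint seq_weight p s U : Qqt :=
  if s is c :: s' then
    choice_weight c (p c) U * seq_weight p s' (if p c is Some d then U :\ d else U)
  else [forall c in U, mu c == 1%N]%:R.

Definition psupp p s := [forall c, isSome (p c) == (c \in s)].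

Lemma eq_seq_weight p p' s U :
  {in s, p =1 p'} -> seq_weight p s U = seq_weight p' s U.
Proof.
elim: s U => //= c s IH U eqp; rewrite eqp ?mem_head // IH // => d ds.
by rewrite eqp // in_cons ds orbT.
Qed.

Lemma sum_seq_weight_cons c s U : c \notin s ->
  \sum_(p | psupp p (c :: s)) seq_weight p (c :: s) U =
  \sum_d choice_weight c (Some d) U
    * \sum_(p | psupp p s) seq_weight p s (U :\ d).
Proof.
move=> c_s.
rewrite (partition_big (fun p : {ffun 'I_n -> option 'I_n} => odflt c (p c)) predT) //=.
apply: eq_bigr => d _; rewrite mulr_sumr.
pose h p := [ffun x => if x == c then Some d else p x] : {ffun 'I_n -> option 'I_n}.
pose h' p := [ffun x => if x == c then None else p x] : {ffun 'I_n -> option 'I_n}.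
rewrite (reindex_onto h h') /=; last first.
  move=> p /andP[/forallP sp /eqP pc]; apply/ffunP => x; rewrite !ffunE.
  case: eqP => // ->; move: (sp c) pc; rewrite mem_head.
  by case: (p c) => //= e _ ->.
apply: eq_big => [p|p _].
  rewrite !ffunE eqxx eqxx andbT; apply/andP/idP.
    case=> /forallP sp /eqP hh; apply/forallP => x.
    have := sp x; rewrite ffunE in_cons; case: (eqVneq x c) => // -> _.
    by rewrite (negbTE c_s) -hh !ffunE eqxx.
  move/forallP => sp; split.
    apply/forallP => x; rewrite ffunE in_cons; case: (eqVneq x c) => //= _.
  apply/eqP/ffunP => x; rewrite !ffunE; case: eqP => // ->.
  by have := sp c; rewrite (negbTE c_s); case: (p c).
rewrite ffunE eqxx; congr (_ * _); apply: eq_seq_weight => x xs.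
by rewrite ffunE; case: eqP => // xc; rewrite xc (negbTE c_s) in xs.
Qed.

(** Mode [l] serves the balls of lowered label l + 1, whose partners carry l + 2. The bound
    [mu c <= l.+2] drops the balls that greater labels will have taken before this mode starts. *)
Definition rcol s U l c : column :=
  ((c \in s) && (nu c == l.+1), (c \in U) && (mu c == l.+2),
   (c \in U) && (mu c <= l.+2)%N).

(** Processing the first ball affects only the mode of its own label: the modes above are empty and
    have value 1, and the modes below see neither the ball nor its partner. In its own mode the
    first step is a trivial pairing, a violation of the rule, or a walk. *)
Lemma sum_seq_weight L s U :
  uniq s -> sorted (fun c d => nu d <= nu c)%N s ->
  {in s, forall c, 0 < nu c <= L}%N -> {in U, forall c, 0 < mu c <= L.+1}%N ->
  (forall l, (l < L)%N ->
    #|[set c | (rcol s U l c).1.1]| = #|[set c | (rcol s U l c).1.2]|) ->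
  \sum_(p | psupp p s) seq_weight p s U =
  \prod_(l < L) mode_value t (q ^+ l.+1) (rcol s U l).
Proof.
elim: s U => [|c s IH] U.
  move=> _ _ _ U_mu cont; rewrite [RHS]big1; last first.
    move=> l _; rewrite (mode_value_empty (qt_neq1 l)) // => c.
    rewrite /rcol /=; have := cont l (ltn_ord l).
    rewrite (_ : [set c | (rcol [::] U l c).1.1] = set0); last first.
      by apply/setP => x; rewrite !inE.
    rewrite cards0 => /esym/eqP; rewrite cards_eq0 => /eqP/setP/(_ c).
    by rewrite !inE /= => ->.
  have all1 : [forall c in U, mu c == 1%N].
    apply/forall_inP => c cU; have /andP[mu1 muL] := U_mu c cU.
    case em: (mu c) mu1 muL => [|[|l]] //= _ lt_l.
    have := cont l lt_l.
    rewrite (_ : [set c | (rcol [::] U l c).1.1] = set0); last first.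
      by apply/setP => x; rewrite !inE.
    rewrite cards0 => /esym/eqP; rewrite cards_eq0 => /eqP/setP/(_ c).
    by rewrite !inE /= cU em eqxx.
  rewrite (big_pred1 [ffun=> None]) /= ?all1 // => p; apply/forallP/eqP => [sp|-> x].
    by apply/ffunP => x; have := sp x; rewrite ffunE; case: (p x).
  by rewrite ffunE.
move=> /= /andP[c_s u_s]; rewrite path_sortedE; last first.
  by move=> x y z h1 h2; apply: leq_trans h1.
case/andP=> /allP c_max so_s s_nu U_mu cont.
rewrite sum_seq_weight_cons //.
have /andP[nu0 nuL] := s_nu c (mem_head _ _).
have lt_l0 : ((nu c).-1 < L)%N by rewrite prednK.
pose l0 := Ordinal lt_l0.
have el0 : nu c = l0.+1 by rewrite /= prednK.
have s_nu' : {in s, forall c, 0 < nu c <= L}%N.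
  by move=> x xs; apply: s_nu; rewrite in_cons xs orbT.
(* The labels above that of c are exhausted. *)
have high l x : (l0 < l < L)%N -> (rcol (c :: s) U l x).1 = (false, false).
  case/andP=> lt_l ltL; have := cont l ltL.
  have a0 y : (y \in c :: s) && (nu y == l.+1) = false.
    apply/negbTE/andP => -[yc /eqP e].
    have : (nu y <= nu c)%N by move: yc; rewrite in_cons => /predU1P[->|/c_max].
    by rewrite e el0; lia.
  rewrite (_ : [set c0 | _] = set0); last first.
    by apply/setP => y; rewrite inE in_set0 /= a0.
  rewrite cards0 => /esym/eqP; rewrite cards_eq0 => /eqP/setP/(_ x).
  by rewrite /rcol !inE /= => ->; rewrite a0.
have U_le x : x \in U -> (mu x <= l0.+2)%N.
  move=> xU; have /andP[mu1 muL] := U_mu x xU; rewrite leqNgt; apply/negP => lt_l.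
  have e : mu x == (mu x).-2.+2 by apply/eqP; lia.
  have : (l0 < (mu x).-2 < L)%N by lia.
  by move/(high _ x); rewrite /rcol xU e /=; case: (_ && _).
pose mv s' U' l := mode_value t (q ^+ l.+1) (rcol s' U' l).
pose rest := \prod_(l < L | l != l0) mv (c :: s) U l.
have eT : \prod_(l < L) mv (c :: s) U l = mv (c :: s) U l0 * rest.
  by rewrite (bigD1 l0).
have rcol_low d l x : mu d = (nu c).+1 -> (l < l0)%N ->
    rcol s (U :\ d) l x = rcol (c :: s) U l x.
  move=> md lt_l; rewrite /rcol !inE; congr (_, _, _).
  - by case: (eqVneq x c) => //= ->; rewrite el0 eqSS gtn_eqF // andbF.
  - by case: (eqVneq x d) => //= ->; rewrite md el0 !eqSS gtn_eqF ?andbF.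
  - by case: (eqVneq x d) => //= ->; rewrite md el0 !ltnS leqNgt lt_l andbF.
have rcol_high d l x : (l0 < l < L)%N -> (rcol s (U :\ d) l x).1 = (false, false).
  move=> /(high _ x); rewrite /rcol !inE => -[h1 h2].
  by rewrite -andbA h2 andbF; move: h1; case: (x \in s); rewrite ?orbT //= => ->.
have eT' d : mu d = (nu c).+1 ->
    \prod_(l < L) mv s (U :\ d) l = mv s (U :\ d) l0 * rest.
  move=> md; rewrite (bigD1 l0) //=; congr (_ * _); apply: eq_bigr => l.
  rewrite -val_eqE neq_ltn => /orP[lt_l|lt_l].
    by apply: eq_mode_value => x; apply: rcol_low.
  rewrite /mv !(mode_value_empty (qt_neq1 l)) // => x.
    by apply: high; rewrite lt_l ltn_ord.
  by apply: rcol_high; rewrite lt_l ltn_ord.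
have IH' d : d \in U -> mu d = (nu c).+1 ->
    \sum_(p | psupp p s) seq_weight p s (U :\ d) = mv s (U :\ d) l0 * rest.
  move=> dU md; rewrite IH // ?eT' //.
    by move=> x; rewrite !inE => /andP[_]; apply: U_mu.
  move=> l ltL; have [lt_l|lt_l|e_l] := ltngtP l l0.
  - rewrite (_ : [set x | (rcol s _ l x).1.1] = [set x | (rcol (c :: s) U l x).1.1]).
      rewrite cont //; congr #|pred_of_set _|; apply/setP => x.
      by rewrite ![in RHS]inE inE rcol_low.
    by apply/setP => x; rewrite ![in RHS]inE inE rcol_low.
  - congr #|pred_of_set _|; apply/setP => x.
    by rewrite ![in RHS]inE inE rcol_high ?lt_l.
  - have := cont l ltL; pose A := [set x | (rcol (c :: s) U l x).1.1].
    pose B := [set x | (rcol (c :: s) U l x).1.2].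
    rewrite -/A -/B (cardsD1 c A) (cardsD1 d B).
    have -> : c \in A by rewrite inE /= mem_head el0 e_l eqxx.
    have -> : d \in B by rewrite inE /= dU md el0 e_l eqxx.
    move/addnI => eAB; transitivity #|A :\ c|.
      congr #|pred_of_set _|; apply/setP => x; rewrite !inE /= in_cons.
      by case: (eqVneq x c) => [->|]; rewrite ?(negbTE c_s).
    rewrite eAB; congr #|pred_of_set _|; apply/setP => x.
    by rewrite !inE /= !inE andbA.
rewrite -/(mv _ _) eT.
(* A free ball directly below [c] is the forced partner. If its label fits, the column drops out of
   the mode; if not, both sides vanish. *)
case cU: (c \in U).
  case mc: (mu c == (nu c).+1).
    rewrite (bigD1 c) //= cU eqxx mc mul1r [X in _ + X]big1 ?addr0; last first.
      by move=> d /negbTE dc; rewrite ?cU dc mul0r.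
    rewrite IH' ?(eqP mc) //; congr (_ * _); 
    rewrite /mv (@mode_value_trivial _ t _ t_neq0 _ (rcol (c :: s) U l0) _ c) //.
    - by rewrite /rcol mem_head cU (eqP mc) el0 !eqxx leqnn.
    - by rewrite /rcol (negbTE c_s) !inE eqxx.
    - by move=> d dc; rewrite /rcol !inE (negbTE dc).
  rewrite big1; last first.
    by move=> d _; rewrite /= cU; case: eqP => [->|]; rewrite ?mc mul0r.
  rewrite /mv (@mode_value_zero _ _ _ _ _ c) ?mul0r //.
  by rewrite /rcol mem_head cU -el0 eqxx mc el0 U_le.
have walk_c := @mode_value_walk _ t (q ^+ l0.+1) t_neq0 (qt_neq1 l0) _
  (rcol (c :: s) U l0) c.
(* As [c] has the greatest label left, every ball of [U] is free in its mode; hence the walk has the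
   denominator required by [pair_weight]. *)
have eU : [set x | (rcol (c :: s) U l0 x).2] = U.
  apply/setP => x; rewrite inE /=; case xU: (x \in U) => //=; exact: U_le.
rewrite (bigID (fun d => (rcol (c :: s) U l0 d).1.2)) /= [X in _ + X]big1 ?addr0; last first.
  by move=> d dN; rewrite cU el0 (negbTE dN) mul0r.
rewrite eU in walk_c.
rewrite -[mv (c :: s) U l0](mulKf (qt_neq1 l0 #|U|)) {1}/mv walk_c; last first.
- exact: cont.
- by rewrite /rcol mem_head cU el0 eqxx.
- by move=> x /= /andP[-> /eqP ->] /=.
rewrite mulr_sumr mulr_suml; apply: eq_bigr => d dB; case/andP: (dB) => dU /eqP md.
rewrite cU el0 dB IH' ?el0 // mulrA; congr (_ * _).
have -> : mode_value t (q ^+ l0.+1) (clear_at (clear_above_at (rcol (c :: s) U l0) c) d)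
    = mv s (U :\ d) l0.
  apply: eq_mode_value => x; rewrite /clear_at /clear_above_at /rcol !inE /clear_below.
  case: (eqVneq x d) => [->|xd]; case: (eqVneq _ c) => [->|xc] //=;
  by rewrite ?(negbTE c_s).
rewrite /pair_weight.
have -> : [set x | (rcol (c :: s) U l0 x).2 && cyc_between c x d] =
    [set x in U | cyc_between c x d].
  apply/setP => x; rewrite !inE /=.
  by case xU: (x \in U) => //=; rewrite U_le.
move: (_^-1) (t ^+ _) (mv _ _ _) (if _ then _ else _) => x y z w.
by ring.
Qed.

Lemma before_irr c : before c c = false.
Proof. by rewrite /before ltnn ltnn andbF andbF !andbF. Qed.

Lemma before_asym c d : before c d -> before d c = false.
Proof. by rewrite /before; apply: contraTF; lia. Qed.

Lemma before_trans : transitive before.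
Proof. by rewrite /before => y x z; lia. Qed.

Lemma before_total c d :
  c != d -> (0 < nu c)%N -> (0 < nu d)%N -> before c d || before d c.
Proof. by rewrite -val_eqE /before /= => /eqP; lia. Qed.

(** Unrolls the recursion. Because [s] is in processing order, the partners removed before [c] can
    be described by [before] alone, without reference to a position in the list. *)
Lemma seq_weight_prod p s U : pairwise before s -> {in s, forall c, p c} ->
  seq_weight p s U =
    (\prod_(c <- s) choice_weight c (p c)
       (U :\: [set d | has (fun x => before x c && (p x == Some d)) s]))
    * [forall c in U :\: [set d | has (fun x => p x == Some d) s], mu c == 1%N]%:R.
Proof.
elim: s U => [|c s IH] U.
  rewrite big_nil mul1r /= => _ _; congr (_%:R); congr (nat_of_bool _).
  apply: eq_forallb => c; congr (_ ==> _).
  by rewrite !inE.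
move=> /= /andP[/allP bc pw] ps; rewrite big_cons.
have s_p : {in s, forall c, p c} by move=> x xs; apply: ps; rewrite in_cons xs orbT.
have := ps c (mem_head _ _); case pc: (p c) => [d|] // _.
rewrite IH // mulrA; congr (_ * _ * _).
- congr choice_weight; apply/setP => x; rewrite !inE before_irr /=.
  rewrite (_ : has _ s = false) //; apply/hasP => -[y ys /andP[]].
  by rewrite (before_asym (bc y ys)).
- apply: eq_big_seq => x xs; congr choice_weight; apply/setP => y.
  rewrite !inE (bc x xs) /= -(eq_sym (Some y)) (inj_eq (@Some_inj _)).
  by case: (y == d); case: has; case: (y \in U).
- congr (_%:R); congr (nat_of_bool _); apply: eq_forallb => x; congr (_ ==> _).
  rewrite !inE -(eq_sym (Some x)) (inj_eq (@Some_inj _)).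
  by case: (x == d); case: has; case: (x \in U).
Qed.

(** [before] is strict; its reflexive closure is total on the balls, as sorting requires. *)
Definition ball_order : seq 'I_n :=
  sort (fun c d => (c == d) || before c d) [seq c <- enum 'I_n | (0 < nu c)%N].

Lemma mem_ball_order c : (c \in ball_order) = (0 < nu c)%N.
Proof. by rewrite mem_sort mem_filter mem_enum andbT. Qed.

Lemma ball_order_uniq : uniq ball_order.
Proof. by rewrite sort_uniq filter_uniq // enum_uniq. Qed.

Lemma ball_order_pairwise : pairwise before ball_order.
Proof.
have := ball_order_uniq.
have : pairwise (fun c d => (c == d) || before c d) ball_order.
  rewrite -sorted_pairwise; last first.
    move=> y x z /predU1P[->//|xy] /predU1P[<-|yz]; first by rewrite xy orbT.
    by rewrite (before_trans xy yz) orbT.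
  apply: (@sort_sorted_in _ (fun c => 0 < nu c)%N).
    move=> c d; rewrite -!topredE /= => c0 d0.
    case: (eqVneq c d) => [->|cd] //=; exact: before_total.
  by apply/allP => c; rewrite mem_filter => /andP[].
elim: ball_order => //= c s IH /andP[/allP bc pw] /andP[c_s u_s].
rewrite IH // andbT; apply/allP => d ds; have /predU1P[e|//] := bc d ds.
by rewrite e ds in c_s.
Qed.

(** A valid pairing has the same factors on both sides, trivial pairings counting 1; for any other
    pairing the sequential weight is 0. *)
Lemma kernel_seq_weight :
  kernel = \sum_(p | psupp p ball_order)
             seq_weight p ball_order [set c | (0 < mu c)%N].
Proof.
rewrite /kernel big_mkcond [RHS]big_mkcond; apply: eq_bigr => p _.
case: (boolP (psupp p ball_order)) => [/forallP sp|spN]; last first.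
  case: pvalidP => // -[h1 _ _ _ _]; case/negP: spN; apply/forallP => c.
  by rewrite h1 mem_ball_order.
have p_some c : isSome (p c) = (0 < nu c)%N by rewrite (eqP (sp c)) mem_ball_order.
have has_matched c d :
    has (fun x => before x c && (p x == Some d)) ball_order = matched p c d.
  apply/hasP/existsP => [[x _ h]|[x h]]; first by exists x.
  by exists x => //; rewrite mem_ball_order; case/andP: h => /and3P[].
have has_pair d : has (fun x => p x == Some d) ball_order = [exists x, p x == Some d].
  apply/hasP/existsP => [[x _ h]|[x h]]; first by exists x.
  by exists x => //; rewrite mem_ball_order -p_some (eqP h).
have free_eq c : [set c | (0 < mu c)%N] :\:
    [set d | has (fun x => before x c && (p x == Some d)) ball_order] = free_set p c.
  by apply/setP => d; rewrite !inE has_matched andbC.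
rewrite seq_weight_prod ?ball_order_pairwise //; last first.
  by move=> c; rewrite mem_ball_order -p_some.
under eq_bigr => c _ do rewrite free_eq.
case: pvalidP => [[h1 h2 h3 h4 h5]|nv].
  have -> : [forall c in [set c | (0 < mu c)%N] :\:
      [set d | has (fun x => p x == Some d) ball_order], mu c == 1%N].
    apply/forall_inP => d; rewrite !inE has_pair negb_exists => /andP[/forallP dN d0].
    by rewrite h4.
  rewrite mulr1 /pairing_prod (bigID (fun c => 0 < nu c)%N) /= [X in _ * X]big1 ?mulr1; last first.
    move=> c; rewrite -p_some => pcN; rewrite big1 // => d /andP[/eqP pc].
    by rewrite pc in pcN.
  rewrite [RHS](perm_big [seq c <- enum 'I_n | (0 < nu c)%N]) /=; last first.
    by rewrite perm_sort.
  rewrite [RHS]big_filter [RHS]big_enum_cond /=; apply: eq_bigr => c nc.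
  have : isSome (p c) by rewrite p_some.
  case pc: (p c) => [d|] // _; have md := h2 _ _ pc.
  rewrite /choice_weight md eqxx !andbT.
  have -> : (c \in free_set p c) = (d == c).
    apply/idP/eqP => [|dc].
      by rewrite inE => /andP[m0 nm]; have := h5 c nc m0 nm; rewrite pc => -[].
    subst d; rewrite inE md /=; apply/existsP => -[x /andP[bx /eqP px]].
    by have xc := h3 _ _ _ px pc; rewrite xc before_irr in bx.
  case: eqP => [->|/eqP dc].
    rewrite big1 // => e /andP[/eqP [<-]].
    by rewrite eqxx.
  have -> : d \in free_set p c.
    rewrite inE md /=; apply/existsP => -[x /andP[bx /eqP px]].
    by have xc := h3 _ _ _ px pc; rewrite xc before_irr in bx.
  rewrite (big_pred1 d) // => e /=; apply/andP/eqP => [[/eqP [->]]|->] //.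
(* If all the factors were nonzero, each of them would enforce part of validity, and [p] would be
   valid. *)
apply/esym/eqP; rewrite mulf_eq0; apply: contraT => /norP[nz1 nz2].
have cw c : (0 < nu c)%N -> choice_weight c (p c) (free_set p c) != 0.
  rewrite -mem_ball_order => cb; move: nz1; rewrite prodf_seq_neq0.
  by move/allP/(_ c cb).
have cwP c d : p c = Some d ->
    [/\ d \in free_set p c, mu d = (nu c).+1 & c \in free_set p c -> d = c].
  move=> pc; have nc : (0 < nu c)%N by rewrite -p_some pc.
  move: (cw c nc); rewrite pc /choice_weight; case cf: (c \in _).
    case: (eqVneq d c) => [->|_] /=; last by rewrite eqxx.
    case e: (mu c == _) => /=; last by rewrite eqxx.
    by move=> _; split=> //; apply/eqP.
  case df: (d \in _) => /=; last by rewrite eqxx.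
  case e: (mu d == _); last by rewrite eqxx.
  by move=> _; split=> //; apply/eqP.
case: nv; split=> //.
- by move=> c d /cwP[].
- move=> c c' d pc pc'; apply/eqP; apply: contraT => cc'.
  have nc : (0 < nu c)%N by rewrite -p_some pc.
  have nc' : (0 < nu c')%N by rewrite -p_some pc'.
  have [d1 _ _] := cwP _ _ pc; have [d2 _ _] := cwP _ _ pc'.
  case/orP: (before_total cc' nc nc') => b.
    by move: d2; rewrite inE => /andP[_ /existsP[]]; exists c; rewrite b pc eqxx.
  by move: d1; rewrite inE => /andP[_ /existsP[]]; exists c'; rewrite b pc' eqxx.
- move=> d d0 dN; move: nz2; case: forall_inP => [al _|]; last by rewrite eqxx.
  by apply/eqP/al; rewrite !inE has_pair d0 andbT; apply/existsP => -[x]; apply/negP.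
- move=> c nc mc mN; have : isSome (p c) by rewrite p_some.
  case pc: (p c) => [d|] // _; have [_ _ ->] := cwP _ _ pc => //.
  by rewrite inE mc.
Qed.

(** Every label of the upper row reappears below with the same multiplicity, and unmatched balls
    only add label 1; otherwise no valid pairing exists. The equalities are the balance condition
    under which the modes are evaluated. *)
Definition content_ok L : bool :=
  [forall l : 'I_L, #|[set c | nu c == l.+1]| == #|[set c | mu c == l.+2]|]
  && [forall c, mu c <= L.+1]%N.

Lemma pvalid_content L p : (forall c, nu c <= L)%N -> pvalid p -> content_ok L.
Proof.
move=> nuL /pvalidP[h1 h2 h3 h4 h5].
have onto d : (1 < mu d)%N -> exists c, p c = Some d.
  move=> d1; case: (pickP (fun c => p c == Some d)) => [c /eqP|nn]; first by exists c.
  have /h4 : (0 < mu d)%N by apply: ltnW.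
  by move=> e; rewrite e // in d1 => c; rewrite nn.
apply/andP; split; last first.
  apply/forallP => d; rewrite leqNgt; apply/negP => lt_d.
  have [|c pc] := onto d; first by apply: leq_ltn_trans lt_d.
  by have := h2 _ _ pc; have := nuL c; lia.
apply/forallP => l; apply/eqP.
pose f c := odflt c (p c).
rewrite -(card_in_imset (f := f)); last first.
  move=> c c'; rewrite !inE => /eqP nc /eqP nc'; rewrite /f.
  have := h1 c; have := h1 c'; rewrite nc nc' /=.
  by case pc': (p c') => [d'|] // _; case pc: (p c) => [d|] // _ /= e; apply: h3 pc _; rewrite e.
congr #|pred_of_set _|; apply/setP => d; rewrite inE; apply/imsetP/eqP => [[c]|md].
  rewrite inE => /eqP nc ->; rewrite /f; have := h1 c; rewrite nc.
  by case pc: (p c) => [e|] // _; rewrite /= (h2 _ _ pc) nc.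
have [|c pc] := onto d; first by rewrite md.
exists c; last by rewrite /f pc.
by rewrite inE; have := h2 _ _ pc; rewrite md => -[->].
Qed.

Definition mcol l c : column :=
  (nu c == l.+1, mu c == l.+2, (0 < mu c <= l.+2)%N).

Lemma kernel_eq L : (forall c, nu c <= L)%N ->
  kernel = if content_ok L
           then \prod_(l < L) mode_value t (q ^+ l.+1) (mcol l) else 0.
Proof.
move=> nuL; case: ifPn => [/andP[/forallP cont /forallP muL]|nc]; last first.
  rewrite /kernel big1 // => p vp; case/negP: nc; exact: pvalid_content vp.
have rm l c : rcol ball_order [set c | (0 < mu c)%N] l c = mcol l c.
  rewrite /rcol /mcol mem_ball_order !inE; congr (_, _, _).
    by case: eqP => [->|]; rewrite ?andbF.
  by case: eqP => [->|]; rewrite ?andbF.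
rewrite kernel_seq_weight (@sum_seq_weight L).
- by apply: eq_bigr => l _; apply: eq_mode_value.
- exact: ball_order_uniq.
- have := ball_order_pairwise; rewrite -(sorted_pairwise before_trans).
  by apply: sub_sorted => c d /and3P[_ _] /orP[/ltnW//|/andP[/eqP->]].
- by move=> c; rewrite mem_ball_order => ->; rewrite nuL.
- by move=> c; rewrite inE => ->; rewrite muL.
move=> l ltL; have /eqP /= eAB := cont (Ordinal ltL).
have -> : [set c | (rcol ball_order [set c | (0 < mu c)%N] l c).1.1] = [set c | nu c == l.+1].
  apply/setP => c; rewrite [LHS]in_set [RHS]in_set.
  by rewrite rm.
have -> // : [set c | (rcol ball_order [set c | (0 < mu c)%N] l c).1.2] = [set c | mu c == l.+2].
by apply/setP => c; rewrite [LHS]in_set [RHS]in_set rm.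
Qed.
End Kernel.

(** * Exchange identities for two adjacent columns *)

Section TwoColumns.
Variables (K : fieldType) (t : K).

Definition two_cells (s : K) (x y : column) : {poly K} :=
  cell x s * cell y (s * step t x).

Lemma enum_ord_adjacent n (i j : 'I_n) : j = i.+1 :> nat ->
  exists cs1 cs2, [/\ enum 'I_n = cs1 ++ i :: j :: cs2,
    {in cs1, forall c, (c != i) && (c != j)} &
    {in cs2, forall c, (c != i) && (c != j)}].
Proof.
move=> ij; have [cs1 [cs2 [eE lt1 lt2 so1 so2]]] := split_enum_ord i.
have : j \in cs1 ++ i :: cs2 by rewrite -eE mem_enum.
rewrite mem_cat in_cons => /or3P[/lt1|/eqP e|].
- by rewrite ij ltnNge leqnSn.
- by move: ij; rewrite e => /eqP; rewrite ltn_eqF.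
case: cs2 so2 lt2 eE => // x cs2 so2 lt2 eE.
rewrite /= path_sortedE in so2; last by move=> ? ? ?; apply: ltn_trans.
case/andP: so2 => /allP x_lt _.
rewrite in_cons => /predU1P[jx|j2]; last first.
  by have := x_lt _ j2; have := lt2 x (mem_head _ _); rewrite ij; lia.
rewrite -jx in x_lt eE; exists cs1, cs2; split=> // c.
  by move/lt1 => lt_c; rewrite -!val_eqE /= ij; lia.
by move/x_lt => lt_c; rewrite -!val_eqE /=; lia.
Qed.

Definition stay (x : column) : bool := x.2 && ~~ x.1.2.

(** The other columns see the two only through the product of their steps, and the prefactor only
    through the number of balls that stay. Rearranging the labels in the two columns preserves both,
    so one functional serves all rearrangements. *)
Lemma mode_value_adjacent u n (i j : 'I_n) : j = i.+1 :> nat ->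
  forall col : 'I_n -> column,
  exists (Lam : {poly K} -> K) (s : K), linear_for *%R Lam /\
  forall col' : 'I_n -> column,
    (forall c, c != i -> c != j -> col' c = col c) ->
    (stay (col' i) + stay (col' j) = stay (col i) + stay (col j))%N ->
    step t (col' i) * step t (col' j) = step t (col i) * step t (col j) ->
  mode_value t u col' = Lam (two_cells s (col' i) (col' j)).
Proof.
move=> ij col; have [cs1 [cs2 [eE ne1 ne2]]] := enum_ord_adjacent ij.
pose s := scale t col 1 cs1.
pose R1 := run t col 1 cs1.
pose R2 := run t col (s * (step t (col i) * step t (col j))) cs2.
exists (fun p => (1 - u * t ^+ #|[set c | stay (col c)]|) * phi t u (R1 * p * R2)), s.
split=> [a p r|col' eqc est estep].
  by rewrite mulrDr mulrDl -scalerAr -scalerAl linearP /= mulrDr mulrCA.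
have eq1 : {in cs1, col' =1 col} by move=> c /ne1/andP[]; apply: eqc.
have eq2 : {in cs2, col' =1 col} by move=> c /ne2/andP[]; apply: eqc.
congr ((1 - u * t ^+ _) * phi t u _).
  rewrite !card_count_enum eE !count_cat /= addnA -/(stay _) -/(stay _).
  rewrite (@eq_in_count _ _ (fun c => stay (col c)) cs1); last first.
    by move=> c /eq1 ->.
  rewrite (@eq_in_count _ _ (fun c => stay (col c)) cs2); last first.
    by move=> c /eq2 ->.
  move: est; rewrite /stay.
  by do 2!move: (count _ _) => ?; do 4!move: (nat_of_bool _) => ?; lia.
rewrite eE run_cat (eq_run _ _ eq1) (eq_scale _ _ eq1) -/R1 -/s /= /two_cells.
by rewrite (eq_run _ _ eq2) -[s * _ * _]mulrA estep -/R2 !mulrA.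
Qed.

Definition pcol (l a k : nat) : column := (a == l.+1, k == l.+2, (0 < k <= l.+2)%N).

Hypothesis tnz : t != 0.

Lemma tmK (r : K) : t * r * t^-1 = r.
Proof. by rewrite mulrAC divff // mul1r. Qed.

Lemma stepE (a b v : bool) :
  step t (a, b, v) = if a then if b then 1 else t else if b then t^-1 else 1.
Proof.
by case: a; case: b; rewrite /step /= ?expr1 ?expr0 ?divr1 ?mul1r ?divff.
Qed.

Ltac mode_cases a b k m l :=
  case: (ltngtP k l.+2) => ?; try (exfalso; lia);
  case: (ltngtP m l.+2) => ?; try (exfalso; lia);
  case: (eqVneq a l.+1) => ?; try (exfalso; lia);
  case: (eqVneq b l.+1) => ?; try (exfalso; lia);
  case: (ltnP 0 k) => ?; try (exfalso; lia);
  case: (ltnP 0 m) => ?; try (exfalso; lia).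

(* Writing s = t * r keeps every scale s, t * s, s / t polynomial in t and r. *)
Ltac mode_tac s a b k m l :=
  rewrite -(tmK s) -(mulrA t s); move: (s / t) => r;
  rewrite /two_cells /pcol; mode_cases a b k m l;
  rewrite /cell ?stepE /= ?tmK ?mulr1 ?mulr1n ?mulr0n -?mul_polyC ?polyCM;
  ring.

(** * Identities for labels a, b above and k, m below two adjacent columns *)

Section LocalIdentities.
Variables (L : nat) (Lam : 'I_L -> {poly K} -> K) (sc : 'I_L -> K).
Hypothesis Lam_lin : forall l, linear_for *%R (Lam l).

(** The left column has [a] above [k], the right column [b] above [m]. *)
Definition loc a k b m : K :=
  \prod_(l < L) Lam l (two_cells (sc l) (pcol l a k) (pcol l b m)).

Lemma LamZ l c p : Lam l (c *: p) = c * Lam l p.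
Proof.
have L0 : Lam l 0 = 0.
  have := Lam_lin l 1 0 0; rewrite scaler0 addr0 mul1r => /eqP.
  by rewrite -[X in X == _]addr0 (inj_eq (addrI _)) eq_sym => /eqP.
by have := Lam_lin l c p 0; rewrite addr0 L0 addr0.
Qed.

Lemma LamD l p r : Lam l (p + r) = Lam l p + Lam l r.
Proof. by have := Lam_lin l 1 p r; rewrite scale1r mul1r. Qed.

Lemma LamB l p r : Lam l (p - r) = Lam l p - Lam l r.
Proof. by rewrite LamD -scaleN1r LamZ mulN1r. Qed.

Lemma Lam0 l : Lam l 0 = 0.
Proof. by rewrite -(scale0r (0 : {poly K})) LamZ mul0r. Qed.

(** In mode a - 1 the ball below is still free but does not carry a + 1, so the trivial pairing rule
    excludes it. *)
Lemma loc_zero_l a k b m : (0 < k <= a)%N -> (a <= L)%N -> loc a k b m = 0.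
Proof.
move=> ka aL; have ltL : (a.-1 < L)%N by lia.
rewrite /loc (bigD1 (Ordinal ltL)) //= /two_cells /pcol prednK; last lia.
have -> : (k == a.+1) = false by lia.
have -> : (0 < k <= a.+1)%N by lia.
by rewrite eqxx /cell /= mul0r Lam0 mul0r.
Qed.

Lemma loc_zero_r a k b m : (0 < k <= a)%N -> (a <= L)%N -> loc b m a k = 0.
Proof.
move=> ka aL; have ltL : (a.-1 < L)%N by lia.
rewrite /loc (bigD1 (Ordinal ltL)) //= /two_cells /pcol prednK; last lia.
have -> : (k == a.+1) = false by lia.
have -> : (0 < k <= a.+1)%N by lia.
by rewrite eqxx /cell /= mulr0 Lam0 mul0r.
Qed.


Lemma loc_eq_k a b k : loc a k b k = loc b k a k.
Proof.
apply: eq_bigr => l _; congr Lam; move: (sc l) => s.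
mode_tac s a b k k l.
Qed.

(** When [a < m], only mode k - 2 notices the order. There [m] is free but receives nothing; to the
    right of the receiver [k] it is passed by one ball less, hence the factor t. When [m <= a], both
    sides are 0. *)
Lemma loc_swap_pos a b k m : (b <= a <= L)%N -> (0 < m < k)%N -> (k <= L.+1)%N ->
  loc a m b k = t * loc b k a m.
Proof.
move=> ba mk kL; have [am|am] := leqP m a.
  by rewrite loc_zero_l ?loc_zero_r ?mulr0 //; lia.
have ltL : (k.-2 < L)%N by lia.
rewrite /loc (bigD1 (Ordinal ltL)) // [in RHS](bigD1 (Ordinal ltL)) //= mulrA.
congr (_ * _).
  rewrite -LamZ; congr Lam; move: (sc _) => s; set l := k.-2.
  mode_tac s a b k m l.
apply: eq_bigr => l; rewrite -val_eqE /= => lk; congr Lam; move: (sc l) => s.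
mode_tac s a b k m l.
Qed.

Lemma loc_swap_zero a b k : (b <= a <= L)%N -> (0 < k)%N ->
  loc a k b 0 = loc b 0 a k.
Proof.
move=> ba k0; have [ka|ak] := leqP k a.
  by rewrite loc_zero_l ?loc_zero_r //; lia.
apply: eq_bigr => l _; congr Lam; move: (sc l) => s.
mode_tac s a b k 0%N l.
Qed.

(** Mode a - 1 decides. If [k <= a], the ball [a] passes the free ball [k] only from the left, which
    gives t. If [k = a + 1], the cells of the three terms, in the order [loc a 0 b k],
    [loc a k b 0], [loc b k a 0], are 1 - t s X, 1 and 1 - s X. If [k > a + 1], the three terms
    agree. *)
Lemma loc_sum_zero a b k : (b < a <= L)%N -> (0 < k <= L.+1)%N ->
  loc a 0 b k - loc a k b 0 = t * (loc b k a 0 - loc a k b 0).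
Proof.
move=> ba k0; have [ka|ak] := leqP k a.
  rewrite (@loc_zero_l a k) ?subr0; [|lia|lia].
  have [kb|bk] := leqP k b.
    by rewrite (@loc_zero_l b k) ?(@loc_zero_r b k) ?mulr0 //; lia.
  have ltL : (a.-1 < L)%N by lia.
  rewrite /loc (bigD1 (Ordinal ltL)) // [in RHS](bigD1 (Ordinal ltL)) //= mulrA.
  congr (_ * _).
    rewrite -LamZ; congr Lam; move: (sc _) => s; set l := a.-1.
    mode_tac s a b k 0%N l.
  apply: eq_bigr => l; rewrite -val_eqE /= => la; congr Lam; move: (sc l) => s.
  mode_tac s a b k 0%N l.
have [ak1|ak1] := eqVneq a.+1 k; last first.
  have e1 : loc a 0 b k = loc a k b 0.
    apply: eq_bigr => l _; congr Lam; move: (sc l) => s.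
    mode_tac s a b k 0%N l.
  have e2 : loc b k a 0 = loc a k b 0.
    apply: eq_bigr => l _; congr Lam; move: (sc l) => s.
    mode_tac s a b k 0%N l.
  by rewrite e1 e2 subrr mulr0.
have ltL : (a.-1 < L)%N by lia.
pose l0 := Ordinal ltL.
pose rest := \prod_(l < L | l != l0) Lam l (two_cells (sc l) (pcol l a k) (pcol l b 0)).
have -> : loc a 0 b k = Lam l0 (two_cells (sc l0) (pcol l0 a 0) (pcol l0 b k)) * rest.
  rewrite /loc (bigD1 l0) //=; congr (_ * _).
  apply: eq_bigr => l; rewrite -val_eqE /= => la; congr Lam; move: (sc l) => s.
  mode_tac s a b k 0%N l.
have -> : loc b k a 0 = Lam l0 (two_cells (sc l0) (pcol l0 b k) (pcol l0 a 0)) * rest.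
  rewrite /loc (bigD1 l0) //=; congr (_ * _).
  apply: eq_bigr => l; rewrite -val_eqE /= => la; congr Lam; move: (sc l) => s.
  mode_tac s a b k 0%N l.
have -> : loc a k b 0 = Lam l0 (two_cells (sc l0) (pcol l0 a k) (pcol l0 b 0)) * rest.
  by rewrite /loc (bigD1 l0).
rewrite -!mulrBl mulrA; congr (_ * _).
rewrite -!LamB -LamZ; congr Lam; move: (sc _) => s; rewrite /=; set l := a.-1.
mode_tac s a b k 0%N l.
Qed.

Lemma loc_sum_pos a b k m :
  (b < a <= L)%N -> (0 < m < k)%N -> (k <= L.+1)%N ->
  loc a k b m + loc a m b k = loc b k a m + loc b m a k.
Proof.
move=> ba mk kL; have [ma|am] := leqP m a.
  rewrite (@loc_zero_l a m) ?(@loc_zero_r a m) ?addr0 ?add0r //; try lia.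
  have [ka|ak] := leqP k a.
    by rewrite loc_zero_l ?loc_zero_r //; lia.
  have [mb|bm] := leqP m b.
    by rewrite (@loc_zero_r b m) ?(@loc_zero_l b m) //; lia.
  (* Now b < m <= a < k. If a + 1 = k, the ball [a] pairs trivially with [k] and passes nothing, so
     the order is invisible in every mode. *)
  have [ak1|ak1] := eqVneq a.+1 k.
    apply: eq_bigr => l _; congr Lam; move: (sc l) => s.
    mode_tac s a b k m l.
  (* Two effects cancel: in mode a - 1 the ball [a] passes the free ball [m] only from the left, and
     in mode k - 2 the receiver [k] to the left of [m] stops one ball before it reaches [m]. They
     give opposite powers of t. *)
  have ltL : (k.-2 < L)%N by lia.
  have ltL' : (a.-1 < L)%N by lia.
  pose l0 := Ordinal ltL; pose l1 := Ordinal ltL'.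
  have n01 : l1 != l0 by rewrite -val_eqE /=; lia.
  rewrite /loc (bigD1 l0) // [in RHS](bigD1 l0) //= (bigD1 l1) // [in RHS](bigD1 l1) //=.
  rewrite !mulrA; congr (_ * _); last first.
    apply: eq_bigr => l; rewrite -!val_eqE /= => /andP[l2 l3]; congr Lam.
    move: (sc l) => s.
    mode_tac s a b k m l.
  rewrite (_ : two_cells (sc l1) (pcol a.-1 a k) _ =
    t *: two_cells (sc l1) (pcol a.-1 b m) (pcol a.-1 a k)); last first.
    move: (sc _) => s; set l := a.-1.
    mode_tac s a b k m l.
  rewrite (_ : two_cells (sc l0) (pcol k.-2 b m) _ =
    t *: two_cells (sc l0) (pcol k.-2 a k) (pcol k.-2 b m)); last first.
    move: (sc _) => s; set l := k.-2.
    mode_tac s a b k m l.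
  by rewrite !LamZ; ring.
have [am1|am1] := eqVneq a.+1 m; last first.
  have -> : loc a k b m = loc b k a m.
    apply: eq_bigr => l _; congr Lam; move: (sc l) => s.
    mode_tac s a b k m l.
  congr (_ + _).
  apply: eq_bigr => l _; congr Lam; move: (sc l) => s.
  mode_tac s a b k m l.
(* Here m = a + 1. In the order of the four terms, mode k - 2 contributes the ratios 1, t, 1, t and
   mode a - 1 the cells 1 - t s X, 1, 1, 1 - s X; the claim becomes (1 - t s X) + t = 1 + t (1 - s
   X). *)
have ltL : (k.-2 < L)%N by lia.
have ltL' : (a.-1 < L)%N by lia.
pose l0 := Ordinal ltL; pose l1 := Ordinal ltL'.
have n01 : l1 != l0 by rewrite -val_eqE /=; lia.
pose rest := \prod_(l < L | (l != l0) && (l != l1))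
  Lam l (two_cells (sc l) (pcol l a k) (pcol l b m)).
have dec a' k' b' m' :
  (forall l : 'I_L, l != l0 -> l != l1 ->
     two_cells (sc l) (pcol l a' k') (pcol l b' m') =
     two_cells (sc l) (pcol l a k) (pcol l b m)) ->
  loc a' k' b' m' =
    Lam l0 (two_cells (sc l0) (pcol l0 a' k') (pcol l0 b' m'))
    * Lam l1 (two_cells (sc l1) (pcol l1 a' k') (pcol l1 b' m')) * rest.
  move=> h; rewrite /loc (bigD1 l0) //= (bigD1 l1) //= mulrA; congr (_ * _).
  by apply: eq_bigr => l /andP[l2 l3]; rewrite h.
rewrite (dec a k b m) // (dec a m b k); last first.
  move=> l; rewrite -!val_eqE /= => l2 l3; move: (sc l) => s.
  mode_tac s a b k m l.
rewrite (dec b k a m); last first.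
  move=> l; rewrite -!val_eqE /= => l2 l3; move: (sc l) => s.
  mode_tac s a b k m l.
rewrite (dec b m a k); last first.
  move=> l; rewrite -!val_eqE /= => l2 l3; move: (sc l) => s.
  mode_tac s a b k m l.
rewrite -!mulrDl; congr (_ * _).
have k1 : two_cells (sc l0) (pcol l0 a m) (pcol l0 b k) =
    t *: two_cells (sc l0) (pcol l0 a k) (pcol l0 b m).
  move: (sc _) => s; rewrite /=; set l := k.-2.
  mode_tac s a b k m l.
have k2 : two_cells (sc l0) (pcol l0 b k) (pcol l0 a m) =
    two_cells (sc l0) (pcol l0 a k) (pcol l0 b m).
  move: (sc _) => s; rewrite /=; set l := k.-2.
  mode_tac s a b k m l.
have k3 : two_cells (sc l0) (pcol l0 b m) (pcol l0 a k) =
    t *: two_cells (sc l0) (pcol l0 a k) (pcol l0 b m).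
  move: (sc _) => s; rewrite /=; set l := k.-2.
  mode_tac s a b k m l.
rewrite k1 k2 k3 !LamZ -!mulrA ![t * (_ * _)]mulrCA -!mulrDr; congr (_ * _).
rewrite -!LamZ -!LamD; congr Lam; move: (sc _) => s; rewrite /=; set l := a.-1.
mode_tac s a b k m l.
Qed.

End LocalIdentities.

End TwoColumns.

(** * Relations between kernels *)

Section KernelIdentities.
Variables (n L : nat) (i j : 'I_n) (nu mu : 'I_n -> nat).
Hypothesis ij : j = i.+1 :> nat.
Hypothesis nuL : forall c, (nu c <= L)%N.
Local Notation sw := (swap_parts i j).

Lemma swap_partsL f : sw f i = f j. Proof. by rewrite /swap_parts tpermL. Qed.
Lemma swap_partsR f : sw f j = f i. Proof. by rewrite /swap_parts tpermR. Qed.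
Lemma swap_partsD f c : c != i -> c != j -> sw f c = f c.
Proof. by move=> ci cj; rewrite /swap_parts tpermD // eq_sym. Qed.

Lemma card_swap_parts f l : #|[set c | sw f c == l]| = #|[set c | f c == l]|.
Proof.
rewrite -[RHS](card_preimset _ (@perm_inj _ (tperm i j))).
by congr #|pred_of_set _|; apply/setP => c; rewrite !inE.
Qed.

Lemma content_swap_l : content_ok (sw nu) mu L = content_ok nu mu L.
Proof.
rewrite /content_ok; congr (_ && _); apply: eq_forallb => l.
by rewrite card_swap_parts.
Qed.

Lemma content_swap_r : content_ok nu (sw mu) L = content_ok nu mu L.
Proof.
rewrite /content_ok; congr (_ && _).
  by apply: eq_forallb => l; rewrite card_swap_parts.
apply/forallP/forallP => h c; last exact: h.
by have := h (tperm i j c); rewrite /swap_parts tpermK.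
Qed.

Lemma kernel_content0 : ~~ content_ok nu mu L -> kernel nu mu = 0.
Proof. by move=> nc; rewrite (kernel_eq mu nuL) (negbTE nc). Qed.

End KernelIdentities.

(** The point is that the same [Lam] and [sc] serve all four kernels, so that the relations between
    them are those of [loc]. *)
Lemma kernel_loc n L (i j : 'I_n) (nu mu : 'I_n -> nat) :
  j = i.+1 :> nat -> (forall c, (nu c <= L)%N) -> content_ok nu mu L ->
  let loc := fun Lam sc => @loc _ t L Lam sc in
  exists (Lam : 'I_L -> {poly Qqt} -> Qqt) (sc : 'I_L -> Qqt),
  [/\ forall l, linear_for *%R (Lam l),
      kernel nu mu = loc Lam sc (nu i) (mu i) (nu j) (mu j),
      kernel nu (swap_parts i j mu) = loc Lam sc (nu i) (mu j) (nu j) (mu i),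
      kernel (swap_parts i j nu) mu = loc Lam sc (nu j) (mu i) (nu i) (mu j) &
      kernel (swap_parts i j nu) (swap_parts i j mu)
        = loc Lam sc (nu j) (mu j) (nu i) (mu i)].
Proof.
move=> ij nuL cont loc.
have adj (l : 'I_L) := @mode_value_adjacent _ t (q ^+ l.+1) n i j ij (mcol nu mu l).
have [Lam {}adj] := fin_all_exists adj; have [sc {}adj] := fin_all_exists adj.
have nuL' c : (swap_parts i j nu c <= L)%N by apply: nuL.
have ker nu' mu' : (forall c, (nu' c <= L)%N) -> content_ok nu' mu' L ->
    (forall c, c != i -> c != j -> nu' c = nu c /\ mu' c = mu c) ->
    (nu' i = nu i /\ nu' j = nu j \/ nu' i = nu j /\ nu' j = nu i) ->
    (mu' i = mu i /\ mu' j = mu j \/ mu' i = mu j /\ mu' j = mu i) ->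
    kernel nu' mu' = loc Lam sc (nu' i) (mu' i) (nu' j) (mu' j).
  move=> h1 h2 h3 h4 h5; rewrite (kernel_eq _ h1) h2; apply: eq_bigr => l _.
  have [_ h] := adj l; rewrite (h (mcol nu' mu' l)) //.
  - by move=> c ci cj; rewrite /mcol; have [-> ->] := h3 c ci cj.
  - by rewrite /stay /mcol /=; case: h5 => -[-> ->] //; rewrite addnC.
  - rewrite /step /mcol /=; rewrite ![(_ / _) * (_ / _)]mulrACA; congr (_ * _).
      by case: h4 => -[-> ->] //; rewrite mulrC.
    by case: h5 => -[-> ->] //; rewrite mulrC.
have eL f := swap_partsL i j f; have eR f := swap_partsR i j f.
have eD f c := @swap_partsD n i j f c.
exists Lam, sc; split.
- by move=> l; case: (adj l).
- by apply: ker => //; left.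
- by rewrite ker ?eL ?eR ?content_swap_r //; [move=> c ci cj; rewrite eD | left | right].
- by rewrite ker ?eL ?eR ?content_swap_l //; [move=> c ci cj; rewrite eD | right | left].
- by rewrite ker ?eL ?eR ?content_swap_l ?content_swap_r //;
    [move=> c ci cj; rewrite !eD | right | right].
Qed.

Section KernelRelations.
Variables (n L : nat) (i j : 'I_n) (nu mu : 'I_n -> nat).
Hypothesis ij : j = i.+1 :> nat.
Hypothesis nuL : forall c, (nu c <= L)%N.
Local Notation sw := (swap_parts i j).

Let nuL' c : (sw nu c <= L)%N. Proof. exact: nuL. Qed.

Lemma kernel_not_content : ~~ content_ok nu mu L ->
  [/\ kernel nu mu = 0, kernel nu (sw mu) = 0, kernel (sw nu) mu = 0
    & kernel (sw nu) (sw mu) = 0].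
Proof.
move=> nc; split; apply: (@kernel_content0 _ L) => //.
- by rewrite content_swap_r.
- by rewrite content_swap_l.
- by rewrite content_swap_l content_swap_r.
Qed.

Lemma kernel_eq_parts : mu i = mu j -> kernel (sw nu) mu = kernel nu mu.
Proof.
move=> e.
have [cont|/kernel_not_content[-> _ -> _]] := boolP (content_ok nu mu L) => //.
have [Lam [sc [lin -> _ -> _]]] := kernel_loc ij nuL cont.
by rewrite e loc_eq_k // t_neq0.
Qed.

Lemma kernel_swap_pos : (nu j <= nu i)%N -> (0 < mu j < mu i)%N ->
  kernel nu (sw mu) = t * kernel (sw nu) mu.
Proof.
move=> ba mk.
have [cont|/kernel_not_content[_ -> -> _]] := boolP (content_ok nu mu L); last by rewrite mulr0.
have [Lam [sc [lin _ -> -> _]]] := kernel_loc ij nuL cont.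
case/andP: cont => _ /forallP muL.
by apply: loc_swap_pos; rewrite ?t_neq0 ?ba ?nuL ?muL.
Qed.

Lemma kernel_sum_pos : (nu j < nu i)%N -> (0 < mu j < mu i)%N ->
  kernel nu mu + kernel nu (sw mu) = kernel (sw nu) mu + kernel (sw nu) (sw mu).
Proof.
move=> ba mk.
have [cont|/kernel_not_content[-> -> -> ->]] := boolP (content_ok nu mu L) => //.
have [Lam [sc [lin -> -> -> ->]]] := kernel_loc ij nuL cont.
case/andP: cont => _ /forallP muL.
by apply: loc_sum_pos; rewrite ?t_neq0 ?ba ?nuL ?muL.
Qed.

Lemma kernel_swap_zero : (nu j <= nu i)%N -> mu j = 0%N -> (0 < mu i)%N ->
  kernel (sw nu) (sw mu) = kernel nu mu.
Proof.
move=> ba mj mi.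
have [cont|/kernel_not_content[-> _ _ ->]] := boolP (content_ok nu mu L) => //.
have [Lam [sc [lin -> _ _ ->]]] := kernel_loc ij nuL cont.
by rewrite mj; apply/esym/loc_swap_zero; rewrite ?t_neq0 ?ba ?nuL.
Qed.

Lemma kernel_sum_zero : (nu j < nu i)%N -> mu j = 0%N -> (0 < mu i)%N ->
  kernel nu (sw mu) - kernel nu mu = t * (kernel (sw nu) mu - kernel nu mu).
Proof.
move=> ba mj mi.
have [cont|/kernel_not_content[-> -> -> _]] := boolP (content_ok nu mu L); last first.
  by rewrite subrr mulr0.
have [Lam [sc [lin -> -> -> _]]] := kernel_loc ij nuL cont.
case/andP: cont => _ /forallP muL.
by rewrite mj; apply: loc_sum_zero; rewrite ?t_neq0 ?ba ?nuL ?mi ?muL.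
Qed.

End KernelRelations.

(** * Peeling off the bottom row *)

Record mlq_spec (L n : nat) (Q : mlq_data L n) : Prop := MlqSpec {
  mlq_top : forall r : 'I_L, r.+1 = L -> (0 < #|row_balls Q r|)%N;
  mlq_card : forall r s : 'I_L, s = r.+1 :> nat ->
    (#|row_balls Q s| <= #|row_balls Q r|)%N;
  mlq_some : forall (s : 'I_L) c,
    isSome (mlq_pair Q (s, c)) = (0 < s)%N && (c \in row_balls Q s);
  mlq_land : forall (r s : 'I_L) c c', s = r.+1 :> nat ->
    mlq_pair Q (s, c) = Some c' -> c' \in row_balls Q r;
  mlq_inj : forall (s : 'I_L) c1 c2 c',
    mlq_pair Q (s, c1) = Some c' -> mlq_pair Q (s, c2) = Some c' -> c1 = c2;
  mlq_label0 : forall (r : 'I_L) c,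
    c \notin row_balls Q r -> mlq_label Q (r, c) = 0%N;
  mlq_label_top : forall (r : 'I_L) c, r.+1 = L -> c \in row_balls Q r ->
    mlq_label Q (r, c) = L;
  mlq_label_pair : forall (r s : 'I_L) c c', s = r.+1 :> nat ->
    mlq_pair Q (s, c) = Some c' -> mlq_label Q (r, c') = mlq_label Q (s, c);
  mlq_label_free : forall (r s : 'I_L) c', s = r.+1 :> nat ->
    c' \in row_balls Q r -> (forall c, mlq_pair Q (s, c) != Some c') ->
    mlq_label Q (r, c') = r.+1;
  mlq_trivial : forall (r s : 'I_L) c, s = r.+1 :> nat ->
    c \in row_balls Q s -> c \in row_balls Q r -> ~~ already_matched Q s c c ->
    mlq_pair Q (s, c) = Some c }.

Lemma mlqP L n (Q : mlq_data L n) : reflect (mlq_spec Q) (is_mlq Q).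
Proof.
apply: (iffP and4P) => [[/andP[h1 h2] /and3P[h3 h4 h5] /and4P[h6 h7 h8 h9] h10]|
    [h1 h2 h3 h4 h5 h6 h7 h8 h9 h10]]; split.
- by move=> r /eqP e; move/forallP/(_ r)/implyP: h1; apply.
- by move=> r s /eqP e; move/forallP/(_ r)/forallP/(_ s)/implyP: h2; apply.
- by move=> s c; apply/eqP; move/forallP/(_ s)/forallP/(_ c): h3.
- move=> r s c c' /eqP e /eqP e'.
  move/forallP/(_ r)/forallP/(_ s)/forallP/(_ c)/forallP/(_ c')/implyP: h4; apply.
  by rewrite e.
- move=> s c1 c2 c' /eqP e /eqP e'; apply/eqP.
  move/forallP/(_ s)/forallP/(_ c1)/forallP/(_ c2)/forallP/(_ c')/implyP: h5; apply.
  by rewrite e.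
- by move=> r c e; apply/eqP; move/forallP/(_ r)/forallP/(_ c)/implyP: h6; apply.
- move=> r c /eqP e e'; apply/eqP; move/forallP/(_ r)/forallP/(_ c)/implyP: h7; apply.
  by rewrite e.
- move=> r s c c' /eqP e /eqP e'; apply/eqP.
  move/forallP/(_ r)/forallP/(_ s)/forallP/(_ c)/forallP/(_ c')/implyP: h8; apply.
  by rewrite e.
- move=> r s c' /eqP e e' /forallP e''; apply/eqP.
  move/forallP/(_ r)/forallP/(_ s)/forallP/(_ c')/implyP: h9; apply.
  by rewrite e e'.
- move=> r s c /eqP e e' e'' e3; apply/eqP.
  move/forallP/(_ r)/forallP/(_ s)/forallP/(_ c)/implyP: h10; apply.
  by rewrite e e' e''.
- apply/andP; split; apply/forallP => r.
    by apply/implyP => /eqP; apply: h1.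
  by apply/forallP => s; apply/implyP => /eqP; apply: h2.
- apply/and3P; split; apply/forallP => r.
  + by apply/forallP => c; rewrite h3.
  + apply/forallP => s; apply/forallP => c; apply/forallP => c'.
    by apply/implyP => /andP[/eqP e /eqP]; apply: h4.
  + apply/forallP => c1; apply/forallP => c2; apply/forallP => c'.
    by apply/implyP => /andP[/eqP e /eqP e']; rewrite (h5 _ _ _ _ e e').
- apply/and4P; split; apply/forallP => r.
  + by apply/forallP => c; apply/implyP => /h6 ->.
  + by apply/forallP => c; apply/implyP => /andP[/eqP e e']; rewrite h7.
  + apply/forallP => s; apply/forallP => c; apply/forallP => c'.
    by apply/implyP => /andP[/eqP e /eqP e']; rewrite (h8 _ _ _ _ e e').
  + apply/forallP => s; apply/forallP => c'.
    by apply/implyP => /and3P[/eqP e e' /forallP e'']; rewrite (h9 r s).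
- apply/forallP => r; apply/forallP => s; apply/forallP => c.
  by apply/implyP => /and4P[/eqP e e' e'' e3]; rewrite (h10 r s).
Qed.

(** Downward induction from the top row: a ball inherits the label of its partner above or gets the
    positive label of its own row. *)
Lemma mlq_label_gt0 L n (Q : mlq_data L n) (r : 'I_L) c :
  mlq_spec Q -> (0 < mlq_label Q (r, c))%N = (c \in row_balls Q r).
Proof.
move=> spec; case cr: (c \in row_balls Q r); last first.
  by rewrite (mlq_label0 spec) ?cr.
move: {2}(L - r.+1)%N (erefl (L - r.+1)%N) => k.
elim: k r c cr => [|k IH] r c cr ek.
  have e : r.+1 = L by have := ltn_ord r; lia.
  by rewrite (mlq_label_top spec e cr) -e.
have lt_s : (r.+1 < L)%N by lia.
pose s := Ordinal lt_s.
case: (pickP (fun d => mlq_pair Q (s, d) == Some c)) => [d /eqP pd|nd].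
  rewrite (mlq_label_pair spec _ pd) //; apply: IH; last by rewrite /=; lia.
  by have := mlq_some spec s d; rewrite pd => /esym /andP[].
by rewrite (@mlq_label_free _ _ _ spec r s) // => d; rewrite nd.
Qed.

Section AddRow.
Variables (M n : nat).
Local Notation L := M.+1.
Implicit Types (mu : 'I_n -> nat) (Q : mlq_data L n).
Implicit Type p : {ffun 'I_n -> option 'I_n}.

Local Notation up r := (lift (ord0 : 'I_L.+1) r).
Local Notation row1 := (up (ord0 : 'I_L)).

(** Labels rise by one because the rows of [Q] move up by one; [p] fills the pairing of the old
    bottom row. [inord] turns an out-of-range [mu] into 0, but a valid pairing bounds [mu]. *)
Definition add_row mu Q p : mlq_data L.+1 n :=
  ([set x | if unlift ord0 x.1 is Some r then (r, x.2) \in mlq_balls Q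
            else (0 < mu x.2)%N],
   [ffun x => if unlift ord0 x.1 is Some r then
                if r == ord0 then p x.2 else mlq_pair Q (r, x.2)
              else None],
   [ffun x => if unlift ord0 x.1 is Some r then
                if (r, x.2) \in mlq_balls Q then inord (mlq_label Q (r, x.2)).+1
                else ord0
              else inord (mu x.2)]).

Definition upper_rows (Q : mlq_data L.+1 n) : mlq_data L n :=
  ([set x | (up x.1, x.2) \in mlq_balls Q],
   [ffun x => if x.1 == ord0 then None else mlq_pair Q (up x.1, x.2)],
   [ffun x => inord (mlq_label Q (up x.1, x.2)).-1]).

Definition bottom_pairing (Q : mlq_data L.+1 n) : {ffun 'I_n -> option 'I_n} :=
  [ffun c => mlq_pair Q (row1, c)].

Section Eqns.
Variables (mu : 'I_n -> nat) (Q : mlq_data L n) (p : {ffun 'I_n -> option 'I_n}).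
Let R := add_row mu Q p.

Lemma row_add0 c : (c \in row_balls R ord0) = (0 < mu c)%N.
Proof. by rewrite !inE /= unlift_none. Qed.

Lemma row_addS r c : (c \in row_balls R (up r)) = (c \in row_balls Q r).
Proof. by rewrite !inE /= liftK. Qed.

Lemma card_row_addS r : #|row_balls R (up r)| = #|row_balls Q r|.
Proof. by apply: eq_card => c; apply: row_addS. Qed.

Lemma pair_add0 c : mlq_pair R (ord0, c) = None.
Proof. by rewrite /mlq_pair /= ffunE /= unlift_none. Qed.

Lemma pair_add1 c : mlq_pair R (row1, c) = p c.
Proof. by rewrite /mlq_pair /= ffunE /= liftK eqxx. Qed.

Lemma pair_addS r c : r != ord0 -> mlq_pair R (up r, c) = mlq_pair Q (r, c).
Proof. by move=> /negbTE r0; rewrite /mlq_pair /= ffunE /= liftK r0. Qed.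

Lemma label_add0 c : mlq_label R (ord0, c) = if (mu c <= L.+1)%N then mu c else 0%N.
Proof.
by rewrite /mlq_label /= ffunE /= unlift_none /inord val_insubd.
Qed.

Lemma label_addS r c : mlq_label R (up r, c) =
  if c \in row_balls Q r then (mlq_label Q (r, c)).+1 else 0%N.
Proof.
rewrite /mlq_label /= ffunE /= liftK !inE; case: ifP => // _.
by rewrite inordK // ltnS ltn_ord.
Qed.

Lemma processed_addS r d c :
  processed_before R (up r) d c = processed_before Q r d c.
Proof.
rewrite /processed_before !row_addS !label_addS.
by case: (d \in _) => //; case: (c \in _) => //=; rewrite ltnS eqSS.
Qed.

Lemma already_addS r c c' : r != ord0 ->
  already_matched R (up r) c c' = already_matched Q r c c'.
Proof.
move=> r0; apply: eq_existsb => d; rewrite processed_addS.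
by rewrite pair_addS.
Qed.

Hypothesis spec : mlq_spec Q.
Local Notation nu := (fun c => mlq_label Q (ord0, c)).

Lemma already_add1 c c' : already_matched R row1 c c' = matched nu p c c'.
Proof.
apply: eq_existsb => d; rewrite processed_addS pair_add1; congr (_ && _).
by rewrite /processed_before /before !(mlq_label_gt0 _ _ spec).
Qed.

Lemma succ_rows (r s : 'I_L.+1) : s = r.+1 :> nat ->
  (r = ord0 /\ s = row1) \/
  exists r' s' : 'I_L, [/\ r = up r', s = up s', s' = r'.+1 :> nat & s' != ord0].
Proof.
case: (unliftP ord0 s) => [s'|] -> //; rewrite lift0 => /succn_inj e.
case: (unliftP ord0 r) e => [r'|] -> e; [right|left].
  by exists r', s'; split=> //; rewrite -?val_eqE /= e ?lift0.
by split=> //; congr lift; apply/val_inj.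
Qed.

Lemma pvalid_add_row : mlq_spec R -> has_type R mu -> pvalid nu mu p.
Proof.
move=> specR /forallP/(_ ord0)/forallP tyR.
have {}tyR c : mlq_label R (ord0, c) = mu c by apply/eqP/(implyP (tyR c)).
have someP c : isSome (p c) = (0 < mlq_label Q (ord0, c))%N.
  by have := mlq_some specR row1 c; rewrite pair_add1 row_addS (mlq_label_gt0 _ _ spec).
apply/pvalidP; split=> //.
- move=> c d pc; rewrite -tyR (@mlq_label_pair _ _ _ specR _ row1 c) ?pair_add1 //.
  by rewrite label_addS -(mlq_label_gt0 _ _ spec) -someP pc.
- by move=> c c' d pc pc'; apply: (mlq_inj specR (s := row1) (c' := d)); rewrite pair_add1.
- move=> d d0 dN; rewrite -tyR (@mlq_label_free _ _ _ specR _ row1) ?row_add0 //.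
  by move=> c; rewrite pair_add1.
- move=> c nc mc mN; rewrite -pair_add1; apply: (mlq_trivial specR (r := ord0)) => //.
  + by rewrite row_addS -(mlq_label_gt0 _ _ spec).
  + by rewrite row_add0.
  + by rewrite already_add1.
Qed.

Lemma add_row_spec : pvalid nu mu p -> mlq_spec R /\ has_type R mu.
Proof.
move=> vp; have nuL c : (mlq_label Q (ord0, c) <= L)%N by rewrite -ltnS ltn_ord.
have muL : forall c, (mu c <= L.+1)%N.
  by have /andP[_ /forallP] := pvalid_content nuL vp.
have label0 c : mlq_label R (ord0, c) = mu c by rewrite label_add0 muL.
case/pvalidP: vp => h1 h2 h3 h4 h5.
have someP c : isSome (p c) = (c \in row_balls Q ord0).
  by rewrite h1 (mlq_label_gt0 _ _ spec).
have label1 c d : p c = Some d -> mlq_label R (row1, c) = (mlq_label Q (ord0, c)).+1.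
  by move=> pc; rewrite label_addS -someP pc.
split; last first.
  apply/forallP => r; apply/forallP => c; apply/implyP => r0.
  by rewrite (_ : r = ord0) ?label0 //; apply/val_inj/eqP.
split.
- move=> r; case: (unliftP ord0 r) => [r'|] -> //; rewrite lift0 => /succn_inj e.
  by rewrite card_row_addS; apply: (mlq_top spec).
- move=> r s /succ_rows[[-> ->]|[r' [s' [-> -> e _]]]]; last first.
    by rewrite !card_row_addS; apply: mlq_card.
  rewrite card_row_addS; pose f c := odflt c (p c).
  rewrite -(card_in_imset (f := f)).
    apply/subset_leq_card/subsetP => d /imsetP[c]; rewrite -someP /f.
    by case pc: (p c) => [e|] // _ ->; rewrite row_add0 (h2 _ _ pc).
  move=> c c'; rewrite -!someP /f.
  case pc: (p c) => [d|] //; case pc': (p c') => [d'|] // _ _ /= e.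
  by apply: h3 pc _; rewrite e.
- move=> s c; case: (unliftP ord0 s) => [s'|] ->; last by rewrite pair_add0.
  rewrite row_addS; have [->|s0] := eqVneq s' ord0; first by rewrite pair_add1 someP.
  rewrite pair_addS // (mlq_some spec); congr (_ && _).
  by rewrite lift0 lt0n -val_eqE /= in s0 *.
- move=> r s c c' /succ_rows[[-> ->]|[r' [s' [-> -> e s0]]]].
    by rewrite pair_add1 row_add0 => /h2 ->.
  by rewrite pair_addS // row_addS; apply: mlq_land.
- move=> s c1 c2 c'; case: (unliftP ord0 s) => [s'|] ->; last by rewrite pair_add0.
  have [->|s0] := eqVneq s' ord0; first by rewrite !pair_add1; apply: h3.
  by rewrite !pair_addS //; apply: mlq_inj.
- move=> r c; case: (unliftP ord0 r) => [r'|] ->.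
    by rewrite row_addS label_addS => /negbTE ->.
  by rewrite row_add0 label0 -eqn0Ngt => /eqP.
- move=> r c; case: (unliftP ord0 r) => [r'|] -> //; rewrite lift0 => /succn_inj e.
  by rewrite row_addS label_addS => cr; rewrite cr (mlq_label_top spec e cr).
- move=> r s c c' /succ_rows[[-> ->]|[r' [s' [-> -> e s0]]]].
    by rewrite pair_add1 label0 => pc; rewrite (label1 _ _ pc); apply: h2.
  rewrite pair_addS // => pc; rewrite !label_addS (mlq_land spec e pc).
  have := mlq_some spec s' c; rewrite pc => /esym/andP[_ ->].
  by rewrite (mlq_label_pair spec e pc).
- move=> r s c' /succ_rows[[-> ->]|[r' [s' [-> -> e s0]]]].
    rewrite row_add0 label0 => m0 cN; apply: h4 => // c.
    by have := cN c; rewrite pair_add1.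
  rewrite row_addS label_addS => cr cN; rewrite cr lift0; congr _.+1.
  by apply: (mlq_label_free spec e cr) => c; have := cN c; rewrite pair_addS.
- move=> r s c /succ_rows[[-> ->]|[r' [s' [-> -> e s0]]]].
    rewrite row_addS row_add0 already_add1 pair_add1 => cr; apply: h5.
    by rewrite (mlq_label_gt0 _ _ spec).
  by rewrite !row_addS already_addS // pair_addS //; apply: mlq_trivial.
Qed.

End Eqns.

(** [add_row] forgets the pairing stored in the bottom row of [Q] and the labels at its empty
    positions; the equation guarantees that these have their default values. *)
Lemma upper_rows_spec mu Q p : mlq_spec (add_row mu Q p) ->
  upper_rows (add_row mu Q p) = Q -> mlq_spec Q.
Proof.
set R := add_row mu Q p => spec eQ.
have pair0 c : mlq_pair Q (ord0, c) = None.
  by rewrite -eQ /mlq_pair /= ffunE.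
have lab0 r c : c \notin row_balls Q r -> mlq_label Q (r, c) = 0%N.
  move=> cr; rewrite -eQ /mlq_label /= ffunE /= inordK.
    by rewrite label_addS (negbTE cr).
  by rewrite label_addS (negbTE cr).
have s_neq (r s : 'I_L) : s = r.+1 :> nat -> s != ord0.
  by move=> e; rewrite -val_eqE /= e.
have eup (r s : 'I_L) : s = r.+1 :> nat -> up s = (up r).+1 :> nat.
  by rewrite !lift0 => ->.
have lab r c : c \in row_balls Q r -> mlq_label R (up r, c) = (mlq_label Q (r, c)).+1.
  by move=> cr; rewrite label_addS cr.
have someP s c : isSome (mlq_pair Q (s, c)) = (0 < s)%N && (c \in row_balls Q s).
  have [->|s0] := eqVneq s ord0; first by rewrite pair0.
  have := mlq_some spec (up s) c; rewrite pair_addS // => ->.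
  by rewrite row_addS lift0 [(0 < s)%N]lt0n -[(s : nat) == 0%N]/(s == ord0) s0.
split=> //.
- move=> r e; rewrite -(card_row_addS mu Q p); apply: (mlq_top spec).
  by rewrite lift0 e.
- move=> r s e; rewrite -!(card_row_addS mu Q p); apply: (mlq_card spec).
  exact: eup.
- move=> r s c c' e pc; rewrite -(row_addS mu Q p).
  by apply: (mlq_land spec (eup _ _ e)); rewrite pair_addS ?(s_neq _ _ e) //; exact: pc.
- move=> s c1 c2 c'; have [->|s0] := eqVneq s ord0; first by rewrite pair0.
  by rewrite -!(pair_addS mu Q p) //; apply: mlq_inj.
- move=> r c e cr; have := mlq_label_top spec (r := up r) (c := c).
  by rewrite lift0 e row_addS lab // => /(_ erefl cr) [].
- move=> r s c c' e pc; have s0 := s_neq _ _ e.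
  have pc' : mlq_pair R (up s, c) = Some c' by rewrite pair_addS.
  have := mlq_label_pair spec (eup _ _ e) pc'.
  have := mlq_land spec (eup _ _ e) pc'; rewrite row_addS => cr.
  have := someP s c; rewrite pc => /esym/andP[_ cs].
  by rewrite !lab // => -[].
- move=> r s c' e cr cN; have s0 := s_neq _ _ e.
  have := mlq_label_free spec (c' := c') (eup _ _ e).
  rewrite row_addS lab // lift0 => h; apply/succn_inj/h => // c.
  by rewrite pair_addS.
- move=> r s c e cs cr nm; have s0 := s_neq _ _ e.
  rewrite -(pair_addS mu Q p) //; apply: (mlq_trivial spec (eup _ _ e)).
  + by rewrite row_addS.
  + by rewrite row_addS.
  + by rewrite already_addS.
Qed.

(** The second condition on the left is the one produced by reindexing along [add_row], whose
    inverse is only partial. *)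
Lemma add_row_valid mu Q p :
  (is_mlq (add_row mu Q p) && has_type (add_row mu Q p) mu)
    && ((upper_rows (add_row mu Q p), bottom_pairing (add_row mu Q p)) == (Q, p))
  = is_mlq Q && pvalid (fun c => mlq_label Q (ord0, c)) mu p.
Proof.
apply/idP/idP.
  case/andP=> /andP[/mlqP specR tyR] /eqP[eQ _].
  have specQ := upper_rows_spec specR eQ.
  by apply/andP; split; [apply/mlqP | apply: pvalid_add_row].
case/andP=> /mlqP specQ vp; have [specR tyR] := add_row_spec specQ vp.
apply/andP; split; first by apply/andP; split; first apply/mlqP.
rewrite xpair_eqE; apply/andP; split; last first.
  by apply/eqP/ffunP => c; rewrite ffunE pair_add1.
case: Q specQ {vp specR tyR} => [[B pr] lb] specQ.
apply/eqP; congr (_, _, _).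
- by apply/setP => -[r c]; rewrite !inE /= liftK.
- apply/ffunP => -[r c]; rewrite ffunE /=; case: eqP => [->|/eqP r0].
    have := mlq_some specQ ord0 c; rewrite /mlq_pair /=.
    by case: (pr _).
  by rewrite pair_addS.
- apply/ffunP => -[r c]; rewrite ffunE /= label_addS; apply/val_inj.
  case: ifP => [cr|/negbT cr].
    by rewrite /= inordK // ltnS -ltnS ltn_ord.
  rewrite /= inordK //.
  by have := mlq_label0 specQ cr; rewrite /mlq_label /= => ->.
Qed.

Lemma add_row_surj mu (Q : mlq_data L.+1 n) : is_mlq Q -> has_type Q mu ->
  add_row mu (upper_rows Q) (bottom_pairing Q) = Q.
Proof.
move=> /mlqP spec /forallP/(_ ord0)/forallP ty.
have {}ty c : mlq_label Q (ord0, c) = mu c by apply/eqP/(implyP (ty c)).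
case: Q spec ty => [[B pr] lb] spec ty; congr (_, _, _).
- apply/setP => -[r c]; rewrite !inE /=.
  case: (unliftP ord0 r) => [r'|] ->; rewrite ?inE //=.
  by rewrite -ty (mlq_label_gt0 _ _ spec) inE.
- apply/ffunP => -[r c]; rewrite !ffunE /=.
  case: (unliftP ord0 r) => [r'|] -> /=.
    case: (eqVneq r' ord0) => [->|r0]; rewrite ?ffunE //= ?(negbTE r0) //.
    by rewrite /mlq_pair /= ffunE /= (negbTE r0).
  have := mlq_some spec ord0 c; rewrite /mlq_pair /=.
  by case: (pr _).
- apply/ffunP => -[r c]; rewrite !ffunE /=; apply/val_inj.
  case: (unliftP ord0 r) => [r'|] -> /=; last first.
    by rewrite -ty /mlq_label /= inord_val.
  rewrite inE /= /mlq_label /= ffunE /=.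
  have := mlq_label_gt0 (up r') c spec; rewrite inE /mlq_label /=.
  have := ltn_ord (lb (up r', c)) => lt_lb.
  case: ifP => _ l0; last by move/negbT: l0; rewrite lt0n negbK => /eqP ->.
  by rewrite !inordK ?prednK // -?ltnS ?prednK // ltnS.
Qed.

End AddRow.

(** The number of rows is a parameter, since in the recursion [nu] ranges over all words with
    entries at most L, whatever their maximum. *)
Definition mlq_sum (L n : nat) (mu : 'I_n -> nat) : {mpoly Qqt[n]} :=
  \sum_(Q : mlq_data L n | is_mlq Q && has_type Q mu) mlq_weight Q.

(** The contribution of the bottom row: one variable for each ball, whatever its label. *)
Definition supp_mon (n : nat) (mu : 'I_n -> nat) : {mpoly Qqt[n]} :=
  \prod_(c < n) 'X_c ^+ (0 < mu c)%N.

Lemma eq_kernel n (nu nu' mu : 'I_n -> nat) :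
  nu =1 nu' -> kernel nu mu = kernel nu' mu.
Proof.
move=> e; have eb d c : before nu d c = before nu' d c by rewrite /before !e.
have em p c d : matched nu p c d = matched nu' p c d.
  by apply: eq_existsb => x; rewrite eb.
have ef p c : free_set nu mu p c = free_set nu' mu p c.
  by apply/setP => x; rewrite !in_set em.
apply: eq_big => [p|p _].
  rewrite /pvalid; congr [&& _, _, _, _ & _].
  - by apply: eq_forallb => c; rewrite e.
  - by apply: eq_forallb => c; apply: eq_forallb => d; rewrite e.
  - by apply: eq_forallb => c; rewrite e em.
by apply: eq_bigr => c _; apply: eq_bigr => d _; rewrite e ef.
Qed.

Lemma eq_mlq_sum L n (mu mu' : 'I_n -> nat) :
  mu =1 mu' -> mlq_sum L mu = mlq_sum L mu'.
Proof.
move=> e; apply: eq_bigl => Q; congr (_ && _).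
by apply: eq_forallb => r; apply: eq_forallb => c; rewrite e.
Qed.

Section Recursion.
Variables (M n : nat).
Local Notation L := M.+1.
Local Notation up r := (lift (ord0 : 'I_L.+1) r).
Local Notation row1 := (up (ord0 : 'I_L)).

Lemma col_add_row mu (Q : mlq_data L n) p j :
  #|col_balls (add_row mu Q p) j| = ((0 < mu j) + #|col_balls Q j|)%N.
Proof.
rewrite -!sum1_card big_mkcond [in RHS]big_mkcond big_ord_recl /=.
congr (_ + _)%N.
  by rewrite -[_ \in col_balls _ _]/(_) !inE /= unlift_none; case: (0 < mu j)%N.
by apply: eq_bigr => r _; rewrite !inE /= liftK.
Qed.

Lemma weight_add_row mu (Q : mlq_data L n) p :
  let nu := fun c => mlq_label Q (ord0, c) in
  mlq_spec Q -> pvalid nu mu p ->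
  mlq_weight (add_row mu Q p) = pairing_prod nu mu p *: (supp_mon mu * mlq_weight Q).
Proof.
move=> nu spec vp; rewrite /mlq_weight -scalerAr scalerA; congr (_ *: _); last first.
  rewrite /supp_mon -big_split; apply: eq_bigr => j _ /=.
  by rewrite col_add_row exprD.
set R := add_row mu Q p.
rewrite big_ord_recl; congr (_ * _).
  rewrite (big_pred1 row1); last first.
    by move=> s /=; rewrite -val_eqE.
  apply: eq_bigr => c _; apply: eq_big => [d|d]; first by rewrite pair_add1.
  rewrite pair_add1 => /andP[/eqP pc dc].
  have cr : c \in row_balls Q ord0.
    by case/pvalidP: vp => /(_ c); rewrite pc (mlq_label_gt0 _ _ spec).
  rewrite /pairing_weight /pair_weight label_addS cr lift0 subSS subn0.
  have -> : free_balls R ord0 row1 c = free_set nu mu p c.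
    by apply/setP => x; rewrite in_set row_add0 already_add1 // in_set.
  by rewrite /skipped_balls (_ : free_balls R ord0 row1 c = free_set nu mu p c) //;
    apply/setP => x; rewrite in_set row_add0 already_add1 // in_set.
apply: eq_bigr => r _.
rewrite big_mkcond big_ord_recl /= mul1r [RHS]big_mkcond.
apply: eq_bigr => s _; rewrite /bump /= !add1n eqSS; case: eqP => // e.
have s0 : s != ord0 by rewrite -val_eqE /= e.
apply: eq_bigr => c _; apply: eq_big => [d|d]; first by rewrite pair_addS.
rewrite pair_addS // => /andP[/eqP pc dc].
have cr : c \in row_balls Q s.
  by have := mlq_some spec s c; rewrite pc => /esym/andP[].
have ef : free_balls R (up r) (up s) c = free_balls Q r s c.
  by apply/setP => x; rewrite [LHS]in_set [RHS]in_set row_addS already_addS.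
by rewrite /pairing_weight /skipped_balls ef label_addS cr lift0 subSS.
Qed.

Lemma mlq_sum_rec (mu : 'I_n -> nat) :
  mlq_sum L.+1 mu =
  \sum_(nu : {ffun 'I_n -> 'I_L.+1})
    kernel (fun c => nu c) mu *: (supp_mon mu * mlq_sum L (fun c => nu c)).
Proof.
rewrite /mlq_sum.
rewrite (reindex_onto (fun x : mlq_data L n * {ffun 'I_n -> option 'I_n} => add_row mu x.1 x.2)
   (fun Q => (upper_rows Q, bottom_pairing Q))); last first.
  by move=> Q /andP[]; apply: add_row_surj.
transitivity (\sum_(x : mlq_data L n * {ffun 'I_n -> option 'I_n} |
    is_mlq x.1 && pvalid (fun c => mlq_label x.1 (ord0, c)) mu x.2)
    mlq_weight (add_row mu x.1 x.2)).
  by apply: eq_bigl => -[Q p]; apply: add_row_valid.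
rewrite -(pair_big_dep (fun Q => is_mlq Q)
  (fun Q p => pvalid (fun c => mlq_label Q (ord0, c)) mu p)
  (fun Q p => mlq_weight (add_row mu Q p))) /=.
transitivity (\sum_(Q : mlq_data L n | is_mlq Q)
   kernel (fun c => mlq_label Q (ord0, c)) mu *: (supp_mon mu * mlq_weight Q)).
  apply: eq_bigr => Q /mlqP spec; rewrite scaler_suml.
  by apply: eq_bigr => p vp; rewrite weight_add_row.
pose ty (Q : mlq_data L n) : {ffun 'I_n -> 'I_L.+1} := [ffun c => Q.2 (ord0, c)].
rewrite (partition_big ty predT) //=; apply: eq_bigr => nu _.
rewrite mulr_sumr scaler_sumr; apply: eq_big => [Q|Q /andP[_ /eqP <-]].
  congr (_ && _); apply/eqP/forallP => [<- r|h].
    apply/forallP => c; apply/implyP => /eqP r0.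
    by rewrite ffunE /mlq_label (_ : r = ord0) //; apply/val_inj.
  apply/ffunP => c; rewrite ffunE; apply/val_inj/eqP.
  by have /forallP/(_ c)/implyP := h ord0; apply.
by congr (_ *: _); apply: eq_kernel => c; rewrite ffunE.
Qed.

End Recursion.

Lemma mlq_sum1 n (mu : 'I_n -> nat) :
  mlq_sum 1 mu =
  if [forall c, mu c <= 1]%N && [exists c, 0 < mu c]%N then supp_mon mu else 0.
Proof.
have pairN (Q : mlq_data 1 n) : mlq_spec Q -> forall x, mlq_pair Q x = None.
  move=> spec [r c]; have := mlq_some spec r c; rewrite [r]ord1.
  by case: mlq_pair.
case: ifPn => [/andP[/forallP mu1 /existsP[c0 c0P]]|nc]; last first.
  rewrite /mlq_sum big_pred0 // => Q; apply: contraNF nc => /andP[/mlqP spec].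
  move=> /forallP/(_ ord0)/forallP ty.
  have {}ty c : mlq_label Q (ord0, c) = mu c by apply/eqP/(implyP (ty c)).
  apply/andP; split; first by apply/forallP => c; rewrite -ty -ltnS ltn_ord.
  have /card_gt0P[c cr] := mlq_top spec (r := ord0) erefl.
  by apply/existsP; exists c; rewrite -ty (mlq_label_gt0 _ _ spec).
pose Q0 : mlq_data 1 n :=
  ([set x | 0 < mu x.2]%N, [ffun=> None], [ffun x => inord (mu x.2)]).
have row0 r c : (c \in row_balls Q0 r) = (0 < mu c)%N by rewrite !inE.
have pair0 x : mlq_pair Q0 x = None by rewrite /mlq_pair ffunE.
have label0 r c : mlq_label Q0 (r, c) = mu c.
  by rewrite /mlq_label ffunE /= inordK // ltnS mu1.
rewrite /mlq_sum (big_pred1 Q0).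
  rewrite /mlq_weight big1 ?scale1r.
    apply: eq_bigr => c _; congr (_ ^+ _); rewrite -sum1_card big_mkcond big_ord1.
    by rewrite !inE /=; case: (0 < mu c)%N.
  by move=> r _; rewrite big1 // => s; rewrite [s]ord1 [r]ord1.
move=> Q; apply/andP/eqP => [[/mlqP spec /forallP/(_ ord0)/forallP ty]|->].
  have {}ty c : mlq_label Q (ord0, c) = mu c by apply/eqP/(implyP (ty c)).
  have pN := pairN _ spec.
  case: Q spec ty pN => [[B pr] lb] spec ty pN; congr (_, _, _).
  - apply/setP => -[r c]; rewrite inE [r]ord1 /= -ty (mlq_label_gt0 _ _ spec).
    by rewrite inE.
  - by apply/ffunP => x; rewrite ffunE; apply: (pN x).
  - apply/ffunP => -[r c]; rewrite ffunE [r]ord1 /= -ty.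
    by rewrite /mlq_label /= inord_val.
split; last by apply/forallP => r; apply/forallP => c; rewrite label0 eqxx implybT.
have noS (r s : 'I_1) : s = r.+1 :> nat -> False by rewrite [s]ord1.
apply/mlqP; split; try by move=> r s *; exfalso; apply: (noS r s).
- by move=> r _; apply/card_gt0P; exists c0; rewrite row0.
- by move=> s c; rewrite pair0 [s]ord1.
- by move=> s c1 c2 c'; rewrite pair0.
- by move=> r c; rewrite row0 label0 lt0n negbK => /eqP.
- move=> r c _; rewrite row0 label0 => m0; apply/eqP.
  by rewrite eqn_leq mu1.
Qed.

(** * The action of s_i on sums and monomials *)

Section Symmetry.
Variables (n : nat) (i j : 'I_n).
Hypothesis ij : j = i.+1 :> nat.
Local Notation sw := (swap_parts i j).
Local Notation s := (msym (tperm i j) : {mpoly Qqt[n]} -> {mpoly Qqt[n]}).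

Lemma msym_var c : s 'X_c = 'X_(tperm i j c).
Proof. by rewrite /msym mmapX mmap1U. Qed.

Lemma msym_supp_mon mu : s (supp_mon mu) = supp_mon (sw mu).
Proof.
rewrite /supp_mon rmorph_prod /= (reindex_inj (@perm_inj _ (tperm i j))) /=.
by apply: eq_bigr => c _; rewrite rmorphXn /= msym_var tpermK.
Qed.

Lemma supp_mon_swap mu : (0 < mu i)%N = (0 < mu j)%N ->
  supp_mon (sw mu) = supp_mon mu.
Proof.
move=> e; apply: eq_bigr => c _; congr (_ ^+ _).
by rewrite /swap_parts; case: tpermP => [->|->|]; rewrite ?e.
Qed.

Lemma supp_mon_zero mu : (0 < mu i)%N -> mu j = 0%N ->
  exists Y, [/\ supp_mon mu = 'X_i * Y, supp_mon (sw mu) = 'X_j * Y & s Y = Y].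
Proof.
move=> mi mj; have ji : j != i by rewrite -val_eqE /= ij gtn_eqF.
pose Y : {mpoly Qqt[n]} := \prod_(c | (c != i) && (c != j)) 'X_c ^+ (0 < mu c)%N.
have eY : s Y = Y.
  rewrite /Y rmorph_prod /=; apply: eq_bigr => c /andP[ci cj].
  by rewrite rmorphXn /= msym_var tpermD // eq_sym.
have e1 : supp_mon mu = 'X_i * Y.
  by rewrite /supp_mon (bigD1 i) //= mi (bigD1 j) //= mj expr1 expr0 mul1r.
exists Y; split=> //; rewrite -msym_supp_mon e1 rmorphM /= eY msym_var tpermL //.
Qed.

(** The summands are not symmetric one by one; where a and b differ, only the sum over an orbit of
    [sg] is, and the orbit is represented by its member with b < a. *)
Lemma msym_sum_pairs (I : finType) (sg : I -> I) (a b : I -> nat)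
    (f : I -> {mpoly Qqt[n]}) :
  involutive sg -> (forall x, a (sg x) = b x) -> (forall x, b (sg x) = a x) ->
  (forall x, a x = b x -> s (f x) = f x) ->
  (forall x, (b x < a x)%N -> s (f x + f (sg x)) = f x + f (sg x)) ->
  s (\sum_x f x) = \sum_x f x.
Proof.
move=> sgK asg bsg h0 h1.
have -> : \sum_x f x =
    \sum_(x | a x == b x) f x + \sum_(x | (b x < a x)%N) (f x + f (sg x)).
  rewrite (bigID (fun x => a x == b x)) /=; congr (_ + _).
  rewrite (bigID (fun x => b x < a x)%N) /= big_split; congr (_ + _).
    by apply: eq_bigl => x; case: (ltngtP (a x) (b x)).
  rewrite (reindex_inj (inv_inj sgK)) /=; apply: eq_bigl => x.
  by rewrite asg bsg; case: (ltngtP (a x) (b x)).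
rewrite rmorphD !rmorph_sum /=; congr (_ + _); apply: eq_bigr => x.
  by move/eqP/h0.
exact: h1.
Qed.

(** The first field is the additive relation at s_i mu = mu, stated without the factor 2. *)
Record exchange (g : ('I_n -> nat) -> {mpoly Qqt[n]}) : Prop := Exchange {
  exch_eq : forall mu, mu i = mu j -> s (g mu) = g mu;
  exch_add : forall mu, (mu j < mu i)%N ->
    s (g mu + g (sw mu)) = g mu + g (sw mu);
  exch_hecke : forall mu, (mu j < mu i)%N ->
    s (t *: ('X_j * g mu) + 'X_i * g (sw mu))
    = t *: ('X_j * g mu) + 'X_i * g (sw mu) }.

End Symmetry.

(** * Exchange relations *)

Section ExchangeInduction.
Variables (n : nat) (i j : 'I_n).
Hypothesis ij : j = i.+1 :> nat.
Local Notation sw := (swap_parts i j).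
Local Notation s := (msym (tperm i j) : {mpoly Qqt[n]} -> {mpoly Qqt[n]}).
Local Notation exchange := (@exchange n i j).

Lemma swap_partsK mu : sw (sw mu) =1 mu.
Proof. by move=> c; rewrite /swap_parts tpermK. Qed.

Lemma swap_parts_id mu : mu i = mu j -> sw mu =1 mu.
Proof. by move=> e c; rewrite /swap_parts; case: tpermP => [->|->|]. Qed.

Lemma msym_Xi : s 'X_i = 'X_j. Proof. by rewrite msym_var tpermL. Qed.
Lemma msym_Xj : s 'X_j = 'X_i. Proof. by rewrite msym_var tpermR. Qed.

(** With parts 0 and 1 only, the strict case has the two sums x_i Y and x_(i+1) Y with Y symmetric,
    or both are 0. *)
Lemma exchange_one_row : exchange (@mlq_sum 1 n).
Proof.
pose b (mu : 'I_n -> nat) := [forall c, mu c <= 1]%N && [exists c, 0 < mu c]%N.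
have bS mu : b (sw mu) = b mu.
  rewrite /b; congr (_ && _).
    apply/forallP/forallP => h c; last exact: h.
    by have := h (tperm i j c); rewrite /swap_parts tpermK.
  apply/existsP/existsP => -[c h]; first by exists (tperm i j c).
  by exists (tperm i j c); rewrite /swap_parts tpermK.
have g mu : mlq_sum 1 mu = if b mu then supp_mon mu else 0 by apply: mlq_sum1.
split=> mu; rewrite !g ?bS; case: ifP => [/andP[/forallP mu1 _]|_];
  rewrite ?mulr0 ?scaler0 ?addr0 ?rmorph0 //.
- by move=> e; rewrite msym_supp_mon supp_mon_swap // e.
- move=> lt_m; have mi := leq_ltn_trans (leq0n _) lt_m.
  have mj : mu j = 0%N by have := mu1 i; lia.
  have [Y [-> -> eY]] := supp_mon_zero ij mi mj.
  by rewrite rmorphD !rmorphM /= eY msym_Xi msym_Xj addrC.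
- move=> lt_m; have mi := leq_ltn_trans (leq0n _) lt_m.
  have mj : mu j = 0%N by have := mu1 i; lia.
  have [Y [-> -> eY]] := supp_mon_zero ij mi mj.
  have sT : s t%:MP_[n] = t%:MP_[n] by rewrite /msym mmapC.
  rewrite -mul_mpolyC rmorphD !rmorphM /= eY sT msym_Xi msym_Xj.
  by rewrite ['X_j * (_ * _)]mulrCA.
Qed.

(* The hypothesis on c says that c nu * g nu + c (s_i nu) * g (s_i nu) is
   al * (g nu + g (s_i nu)) + be * (t x_{i+1} g nu + x_i g (s_i nu)). *)
Lemma msym_kernel_sum M (c : ('I_n -> nat) -> {mpoly Qqt[n]}) :
  exchange (@mlq_sum M n) ->
  (forall nu nu', nu =1 nu' -> c nu = c nu') ->
  (forall nu, (forall k, (nu k <= M)%N) -> nu i = nu j -> s (c nu) = c nu) ->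
  (forall nu, (forall k, (nu k <= M)%N) -> (nu j < nu i)%N ->
     exists al be, [/\ s al = al, s be = be,
       c nu = al + be * (t *: 'X_j) & c (sw nu) = al + be * 'X_i]) ->
  s (\sum_(nu : {ffun 'I_n -> 'I_M.+1}) c (fun k => nu k) * mlq_sum M (fun k => nu k))
  = \sum_(nu : {ffun 'I_n -> 'I_M.+1}) c (fun k => nu k) * mlq_sum M (fun k => nu k).
Proof.
move=> [g0 g1 g2] cE c0 c1.
pose sg (nu : {ffun 'I_n -> 'I_M.+1}) := [ffun k => nu (tperm i j k)].
have sgE nu : (fun k => sg nu k : nat) =1 sw (fun k => nu k).
  by move=> k; rewrite ffunE.
have nuM (nu : {ffun 'I_n -> 'I_M.+1}) k : (nu k <= M)%N by rewrite -ltnS.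
apply: (@msym_sum_pairs n i j _ sg (fun nu => nu i) (fun nu => nu j)).
- by move=> nu; apply/ffunP => k; rewrite !ffunE tpermK.
- by move=> nu; rewrite ffunE tpermL.
- by move=> nu; rewrite ffunE tpermR.
- by move=> nu e; rewrite rmorphM /= c0 // g0.
move=> nu lt_nu; rewrite (cE _ _ (sgE nu)) (eq_mlq_sum _ (sgE nu)).
have [al [be [sal sbe -> ->]]] := c1 (fun k => nu k) (nuM nu) lt_nu.
set a := mlq_sum M _; set b := mlq_sum M _.
have -> : (al + be * (t *: 'X_j)) * a + (al + be * 'X_i) * b =
  al * (a + b) + be * (t *: ('X_j * a) + 'X_i * b).
  by rewrite -!mul_mpolyC; ring.
by rewrite rmorphD !rmorphM /= sal sbe g1 // g2.
Qed.

(** In the strict cases mu_(i+1) = 0 is separated: there s_i changes the monomial of the new row,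
    while for mu_(i+1) > 0 that monomial is symmetric and only the kernels matter. *)
Lemma exchange_add_row M : exchange (@mlq_sum M.+1 n) -> exchange (@mlq_sum M.+2 n).
Proof.
move=> exM; pose ker (nu mu : 'I_n -> nat) := (kernel nu mu)%:MP_[n].
have kE nu nu' mu : nu =1 nu' -> ker nu mu = ker nu' mu.
  by move=> e; rewrite /ker (eq_kernel _ e).
have sk nu mu : s (ker nu mu) = ker nu mu by rewrite /ker /msym mmapC.
have rec mu : mlq_sum M.+2 mu = \sum_(nu : {ffun 'I_n -> 'I_M.+2})
    (ker (fun k => nu k) mu * supp_mon mu) * mlq_sum M.+1 (fun k => nu k).
  rewrite mlq_sum_rec; apply: eq_bigr => nu _.
  by rewrite -mulrA mul_mpolyC.
pose T := t%:MP_[n]; have sT : s T = T by rewrite /T /msym mmapC.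
have sker nu mu : nu i = nu j -> ker (sw nu) mu = ker nu mu.
  by move=> e; apply: kE; apply: swap_parts_id.
split=> mu.
- move=> e; rewrite rec.
  have se : s (supp_mon mu) = supp_mon mu.
    by rewrite msym_supp_mon supp_mon_swap // e.
  apply: (msym_kernel_sum (c := fun nu => ker nu mu * supp_mon mu) exM).
  + by move=> nu nu' /kE ->.
  + by move=> nu nuM _; rewrite rmorphM /= sk se.
  move=> nu nuM _; exists (ker nu mu * supp_mon mu), 0.
  rewrite rmorph0 rmorphM /= sk se !mul0r !addr0; split=> //.
  by rewrite /ker (@kernel_eq_parts _ M.+1).
- move=> lt_m; have mi := leq_ltn_trans (leq0n _) lt_m.
  rewrite !rec -big_split /=.
  under eq_bigr => nu _ do rewrite -mulrDl.
  apply: (msym_kernel_sum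
    (c := fun nu => ker nu mu * supp_mon mu + ker nu (sw mu) * supp_mon (sw mu)) exM).
  + by move=> nu nu' e; rewrite !(kE _ _ _ e).
  + move=> nu nuM e; have [mj|mj] := posnP (mu j).
      have [Y [-> -> eY]] := supp_mon_zero ij mi mj.
      have -> : ker nu (sw mu) = ker nu mu.
        rewrite -(sker _ (sw mu) e) /ker (@kernel_swap_zero _ M.+1 i j nu mu) ?e //.
      by rewrite rmorphD !rmorphM /= eY sk msym_Xi msym_Xj addrC.
    have eS := @supp_mon_swap _ i j mu; rewrite mi mj in eS.
    by rewrite eS // rmorphD !rmorphM /= !sk msym_supp_mon eS.
  + move=> nu nuM lt_nu; have [mj|mj] := posnP (mu j).
      have [Y [-> -> eY]] := supp_mon_zero ij mi mj.
      have e22 : ker (sw nu) (sw mu) = ker nu mu.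
        by rewrite /ker (@kernel_swap_zero _ M.+1 i j nu mu) // ltnW.
      have e12 : ker nu (sw mu) = ker nu mu + T * (ker (sw nu) mu - ker nu mu).
        rewrite /ker /T -mpolyCB -mpolyCM -mpolyCD; congr (_%:MP_[n]).
        by rewrite -(@kernel_sum_zero _ M.+1 i j nu mu) // addrC subrK.
      (* Let D be the difference of kernels in [be]. By [e12], the coefficient of [nu] exceeds the
         symmetric part by t D Y x_(i+1), and that of [sw nu] by D Y x_i: exactly the shape of the
         second relation. *)
      exists (ker nu mu * Y * ('X_i + 'X_j)), (Y * (ker (sw nu) mu - ker nu mu)).
      rewrite !rmorphM !rmorphB rmorphD /= !sk eY msym_Xi msym_Xj e22 e12.
      split=> //; first by rewrite ['X_j + _]addrC.
        by rewrite -mul_mpolyC -/T; ring.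
      by ring.
    have eS := @supp_mon_swap _ i j mu; rewrite mi mj in eS; rewrite eS //.
    have eSum : ker (sw nu) mu + ker (sw nu) (sw mu) = ker nu mu + ker nu (sw mu).
      rewrite /ker -!mpolyCD; congr (_%:MP_[n]).
      by rewrite (@kernel_sum_pos _ M.+1 i j nu mu) // mj.
    exists ((ker nu mu + ker nu (sw mu)) * supp_mon mu), 0.
    rewrite rmorph0 rmorphM rmorphD /= !sk msym_supp_mon eS //.
    by rewrite !mul0r !addr0 -!mulrDl eSum.
- move=> lt_m; have mi := leq_ltn_trans (leq0n _) lt_m.
  rewrite !rec -mul_mpolyC -/T !mulr_sumr -big_split /=.
  under eq_bigr => nu _ do rewrite !mulrA -mulrDl.
  apply: (msym_kernel_sum
    (c := fun nu => T * 'X_j * ker nu mu * supp_mon mu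
                    + 'X_i * ker nu (sw mu) * supp_mon (sw mu)) exM).
  + by move=> nu nu' e; rewrite !(kE _ _ _ e).
  + move=> nu nuM e; have [mj|mj] := posnP (mu j).
      have [Y [-> -> eY]] := supp_mon_zero ij mi mj.
      have -> : ker nu (sw mu) = ker nu mu.
        rewrite -(sker _ (sw mu) e) /ker (@kernel_swap_zero _ M.+1 i j nu mu) ?e //.
      rewrite rmorphD !rmorphM /= eY !sk sT msym_Xi msym_Xj; ring.
    have eS := @supp_mon_swap _ i j mu; rewrite mi mj in eS.
    have -> : ker nu (sw mu) = T * ker nu mu.
      rewrite -(sker _ mu e) /ker /T -mpolyCM.
      by rewrite (@kernel_swap_pos _ M.+1 i j nu mu) ?e // mj.
    rewrite eS // rmorphD !rmorphM /= !sk sT msym_supp_mon eS // msym_Xi msym_Xj; ring.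
  + move=> nu nuM lt_nu; have [mj|mj] := posnP (mu j).
      have [Y [-> -> eY]] := supp_mon_zero ij mi mj.
      have e22 : ker (sw nu) (sw mu) = ker nu mu.
        by rewrite /ker (@kernel_swap_zero _ M.+1 i j nu mu) // ltnW.
      have e12 : ker nu (sw mu) = ker nu mu + T * (ker (sw nu) mu - ker nu mu).
        rewrite /ker /T -mpolyCB -mpolyCM -mpolyCD; congr (_%:MP_[n]).
        by rewrite -(@kernel_sum_zero _ M.+1 i j nu mu) // addrC subrK.
      (* Both monomials become x_i x_(i+1) Y, and by [e12] and [e22] the coefficients of [nu] and
         [sw nu] coincide, so only the additive relation is used. *)
      exists ('X_i * 'X_j * Y * (T * ker (sw nu) mu + ker nu mu)), 0.
      rewrite rmorph0 !rmorphM rmorphD /= !rmorphM /= !sk eY sT msym_Xi msym_Xj e22 e12.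
      split=> //; [|ring|ring].
      by rewrite ['X_j * 'X_i]mulrC.
    have eS := @supp_mon_swap _ i j mu; rewrite mi mj in eS; rewrite eS //.
    have e12 : ker nu (sw mu) = T * ker (sw nu) mu.
      rewrite /ker /T -mpolyCM (@kernel_swap_pos _ M.+1 i j nu mu) ?mj //.
      exact: ltnW.
    have e22 : ker (sw nu) (sw mu) = ker nu mu + ker nu (sw mu) - ker (sw nu) mu.
      rewrite /ker -!mpolyCD -mpolyCB; congr (_%:MP_[n]).
      by rewrite (@kernel_sum_pos _ M.+1 i j nu mu) ?mj // addrC addKr.
    (* Comparing the x_i terms at [nu] gives [al], as [be] enters there only with x_(i+1). The
       x_(i+1) terms then give [be] through [e12], and [e22] is what makes the coefficient of
       [sw nu] agree. *)
    exists (supp_mon mu * ker nu (sw mu) * ('X_i + 'X_j)),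
           (supp_mon mu * (ker nu mu - ker (sw nu) mu)).
    rewrite !rmorphM rmorphB rmorphD /= !sk msym_supp_mon eS // msym_Xi msym_Xj.
    rewrite e22 e12 -mul_mpolyC -/T; split=> //; [|ring|ring].
    by rewrite ['X_j + _]addrC.
Qed.

Lemma exchange_mlq_sum M : exchange (@mlq_sum M.+1 n).
Proof.
by elim: M => [|M]; [apply: exchange_one_row | apply: exchange_add_row].
Qed.

End ExchangeInduction.

Theorem theorem3p4 (n : nat) (mu : 'I_n -> nat)
    (mu_neq0 : exists k, mu k <> 0%N)
    (i j : 'I_n) (ij : j = i.+1 :> nat) :
  let s := msym (tperm i j) in
  let smu := swap_parts i j mu in
  let G := F mu + F smu in
  let H := t *: ('X_j * F mu) + 'X_i * F smu in
  G - s G = 0 /\ ((mu j < mu i)%N -> H - s H = 0).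
Proof.
move=> s smu G H.
have [M eM] : exists M, \max_(c < n) mu c = M.+1.
  case: mu_neq0 => k /eqP; rewrite -lt0n => mk.
  by have := leq_trans mk (leq_bigmax k); case: (\max_(c < n) mu c) => // M _; exists M.
have eF : F mu = mlq_sum M.+1 mu by rewrite /F eM.
have eM' : \max_(c < n) smu c = M.+1.
  rewrite -eM [RHS](reindex_inj (@perm_inj _ (tperm i j))).
  by apply: eq_bigr.
have eF' : F smu = mlq_sum M.+1 smu by rewrite /F eM'.
have [h0 h1 h2] := exchange_mlq_sum ij M.
split; last first.
  by move=> lt_m; apply/eqP; rewrite subr_eq0 eq_sym /H eF eF' /s h2.
apply/eqP; rewrite subr_eq0 eq_sym /G eF eF' /s; apply/eqP.
(* The additive relation is symmetric in mu and s_i mu, so the case mu_i < mu_(i+1) is the strict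
   case for s_i mu. *)
have [lt_m|lt_m|e] := ltngtP (mu i) (mu j); last 1 first.
- have -> : mlq_sum M.+1 smu = mlq_sum M.+1 mu.
    by apply: eq_mlq_sum; apply: swap_parts_id.
  by rewrite rmorphD /= h0.
- have := h1 smu; rewrite /smu swap_partsL swap_partsR => /(_ lt_m).
  by rewrite (eq_mlq_sum _ (swap_partsK i j mu)) addrC.
- exact: h1.
Qed.
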